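(* Let $\pi\colon(\overline M,\overline{\mathrm g})\to(M,\mathrm g)$ be a Riemannian submersion. If $(\overline M,\overline{\mathrm g})$ has strongly positive curvature, then $(M,\mathrm g)$ also has strongly positive curvature.
   Context: For a finite-dimensional inner product space $V$, $\Lambda^kV$ carries the induced inner product and is identified with the space of $k$-forms on $V$. Each $\omega\in\Lambda^4V$ is viewed as a self-adjoint operator $\omega\colon\Lambda^2V\to\Lambda^2V$ via $\langle\omega(X\wedge Y),Z\wedge W\rangle=\omega(X,Y,Z,W)$. The curvature operator of a Riemannian manifold at $p$ is the self-adjoint operator $R\colon\Lambda^2T_pM\to\Lambda^2T_pM$ given by $\langle R(X\wedge Y),Z\wedge W\rangle=\langle\nabla_{[X,Y]}Z-\nabla_X\nabla_YZ+\nabla_Y\nabla_XZ,W\rangle$, so that $\langle R(X\wedge Y),X\wedge Y\rangle$ is the sectional curvature of the plane spanned by orthonormal $X,Y$. A Riemannian manifold $(M,\mathrm g)$ has strongly positive curvature if for every $p\in M$ there exists $\omega\in\Lambda^4T_pM$ such that $R+\omega\colon\Lambda^2T_pM\to\Lambda^2T_pM$ is positive-definite. *)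

(* Defs.v *)
From HB Require Import structures.
From mathcomp Require Import all_boot all_order all_algebra ring.
From mathcomp Require Import all_classical all_reals all_analysis.
Set Implicit Arguments.
Unset Strict Implicit.
Unset Printing Implicit Defensive.
Import Order.TTheory GRing.Theory Num.Theory numFieldNormedType.Exports.
Local Open Scope classical_set_scope.
Local Open Scope ring_scope.

(* On an open set [U] this is the usual class C^k: [f] is C^(k+1) iff it is
   differentiable with C^k derivatives in all constant directions. *)
Fixpoint Ck_on (R : realType) (V W : normedModType R) (k : nat) (U : set V)
    (f : V -> W) : Prop :=
  match k with
  | 0%N => forall x, U x -> {for x, continuous f}
  | k'.+1 => (forall x, U x -> differentiable f x) /\
             (forall v, Ck_on k' U ('D_v f))
  end.

Definition smooth_on (R : realType) (V W : normedModType R) (U : set V)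
    (f : V -> W) : Prop := forall k, Ck_on k U f.

(* [coord] and [param] are total functions; only their values on [dom] and
   [img] are meaningful, where they are inverse homeomorphisms. *)
Record chart (R : realType) (n : nat) (T : topologicalType) := Chart {
  dom : set T;
  img : set 'rV[R]_n;
  coord : T -> 'rV[R]_n;
  param : 'rV[R]_n -> T;
  dom_open : open dom;
  img_open : open img;
  coord_img : forall p, dom p -> img (coord p);
  param_dom : forall x, img x -> dom (param x);
  coordK : forall p, dom p -> param (coord p) = p;
  paramK : forall x, img x -> coord (param x) = x;
  coord_continuous : forall p, dom p -> {for p, continuous coord};
  param_continuous : forall x, img x -> {for x, continuous param} }.

Definition smooth_compatible (R : realType) (n : nat) (T : topologicalType)
    (c d : chart R n T) : Prop :=
  smooth_on [set x | img c x /\ dom d (param c x)] (coord d \o param c).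

(* The atlas comes with a preferred chart around each point. It serves to
   identify the tangent space at [p] with R^n: a tangent vector at [p] is the
   row of its components in the coordinates of [chart_at p]. *)
Record manifold (R : realType) (n : nat) := Manifold {
  points :> topologicalType;
  atlas : set (chart R n points);
  chart_at : points -> chart R n points;
  manifold_hausdorff : hausdorff_space points;
  manifold_second_countable : @second_countable points;
  chart_at_atlas : forall p, atlas (chart_at p);
  chart_at_dom : forall p, dom (chart_at p) p;
  atlas_smooth : forall c d, atlas c -> atlas d -> smooth_compatible c d }.

Definition smooth_map (R : realType) (m n : nat) (M : manifold R m)
    (N : manifold R n) (f : M -> N) : Prop :=
  continuous f /\
  forall c d, atlas c -> atlas d ->
    smooth_on [set x | img c x /\ dom d (f (param c x))]
              (coord d \o f \o param c).

Definition tangent_map (R : realType) (m n : nat) (M : manifold R m)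
    (N : manifold R n) (f : M -> N) (p : M) : 'rV[R]_m -> 'rV[R]_n :=
  'd (coord (chart_at (f p)) \o f \o param (chart_at p))
     (coord (chart_at p) p).

Definition inner (R : realType) (n : nat) (G : 'M[R]_n) (u v : 'rV[R]_n) : R :=
  (u *m G *m v^T) 0 0.

(* [coord_gram gram c x] is the matrix (g_ij) at [x] of the metric in the chart
   [c]: [J] sends components in [c] to components in the preferred chart. *)
Definition coord_gram (R : realType) (n : nat) (M : manifold R n)
    (gram : M -> 'M[R]_n) (c : chart R n M) (x : 'rV[R]_n) : 'M[R]_n :=
  let q := param c x in
  let J : 'rV[R]_n -> 'rV[R]_n := 'd (coord (chart_at q) \o param c) x in
  \matrix_(i < n, j < n) inner (gram q) (J (delta_mx 0 i)) (J (delta_mx 0 j)).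

Record metric (R : realType) (n : nat) (M : manifold R n) := Metric {
  gram : M -> 'M[R]_n;
  gram_sym : forall p, (gram p)^T = gram p;
  gram_pos : forall p v, v != 0 -> 0 < inner (gram p) v v;
  gram_smooth : forall c, atlas c -> smooth_on (img c) (coord_gram gram c) }.

Definition riemannian_submersion (R : realType) (m n : nat)
    (Mbar : manifold R m) (gbar : metric Mbar)
    (M : manifold R n) (g : metric M) (f : Mbar -> M) : Prop :=
  [/\ smooth_map f,
      forall q : M, exists p, f p = q,
      forall (p : Mbar) (w : 'rV[R]_n), exists v, tangent_map f p v = w
    & forall (p : Mbar) (u v : 'rV[R]_m),
        let horizontal h :=
          forall k, tangent_map f p k = 0 -> inner (gram gbar p) h k = 0 in
        horizontal u -> horizontal v ->
        inner (gram g (f p)) (tangent_map f p u) (tangent_map f p v) =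
        inner (gram gbar p) u v].

(* Christoffel symbols of the metric [G] on an open set of R^n:
   2 g(Gamma(u, v), e_k) =
     (d_u g)(v, e_k) + (d_v g)(u, e_k) - (d_{e_k} g)(u, v). *)
Definition christoffel (R : realType) (n : nat) (G : 'rV[R]_n -> 'M[R]_n)
    (x u v : 'rV[R]_n) : 'rV[R]_n :=
  2^-1 *: (\row_(k < n) (inner ('D_u G x) v (delta_mx 0 k)
                       + inner ('D_v G x) u (delta_mx 0 k)
                       - inner ('D_(delta_mx 0 k) G x) u v)) *m invmx (G x).

(* The Levi-Civita connection of [G]; see [nabla_metric] and
   [nabla_torsion_free]. *)
Definition nabla (R : realType) (n : nat) (G : 'rV[R]_n -> 'M[R]_n)
    (X Y : 'rV[R]_n -> 'rV[R]_n) (x : 'rV[R]_n) : 'rV[R]_n :=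
  'D_(X x) Y x + christoffel G x (X x) (Y x).

Definition bracket (R : realType) (n : nat) (X Y : 'rV[R]_n -> 'rV[R]_n)
    (x : 'rV[R]_n) : 'rV[R]_n :=
  'D_(X x) Y x - 'D_(Y x) X x.

(* The sign is such that [inner (G x) (curv G X Y X x) (Y x)] is the sectional
   curvature when [X x] and [Y x] are orthonormal. *)
Definition curv (R : realType) (n : nat) (G : 'rV[R]_n -> 'M[R]_n)
    (X Y Z : 'rV[R]_n -> 'rV[R]_n) (x : 'rV[R]_n) : 'rV[R]_n :=
  nabla G (bracket X Y) Z x - nabla G X (nabla G Y Z) x
  + nabla G Y (nabla G X Z) x.

(* Tangent vectors at [p] are extended to vector fields with constant
   components in [chart_at p]. *)
Definition riemann (R : realType) (n : nat) (M : manifold R n) (g : metric M)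
    (p : M) (x y z w : 'rV[R]_n) : R :=
  let c := chart_at p in
  inner (gram g p)
    (curv (coord_gram (gram g) c) (cst x) (cst y) (cst z) (coord c p)) w.

Record alternating4 (R : realType) (n : nat)
    (omega : 'rV[R]_n -> 'rV[R]_n -> 'rV[R]_n -> 'rV[R]_n -> R) : Prop :=
  Alternating4 {
  alt4_lin1 : forall y z w, scalar (fun x => omega x y z w);
  alt4_lin2 : forall x z w, scalar (fun y => omega x y z w);
  alt4_lin3 : forall x y w, scalar (fun z => omega x y z w);
  alt4_lin4 : forall x y z, scalar (fun w => omega x y z w);
  alt4_12 : forall x z w, omega x x z w = 0;
  alt4_23 : forall x y w, omega x y y w = 0;
  alt4_34 : forall x y z, omega x y z z = 0 }.

(* Lambda^2 of R^n is realized as the space of skew-symmetric matrices. *)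
Definition bivector (R : realType) (n : nat) (A : 'M[R]_n) : Prop := A^T = - A.

Definition wedge (R : realType) (n : nat) (x y : 'rV[R]_n) : 'M[R]_n :=
  x^T *m y - y^T *m x.

(* The inner product on Lambda^2 induced by [G]; see [inner2_wedge]. *)
Definition inner2 (R : realType) (n : nat) (G A B : 'M[R]_n) : R :=
  2^-1 * \tr (G *m A *m G *m B^T).

Definition operator_of (R : realType) (n : nat) (G : 'M[R]_n)
    (Q : 'rV[R]_n -> 'rV[R]_n -> 'rV[R]_n -> 'rV[R]_n -> R)
    (T : {linear 'M[R]_n -> 'M[R]_n}) : Prop :=
  (forall A, bivector A -> bivector (T A)) /\
  (forall x y z w, inner2 G (T (wedge x y)) (wedge z w) = Q x y z w).

Definition positive_definite (R : realType) (n : nat) (G : 'M[R]_n)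
    (T : 'M[R]_n -> 'M[R]_n) : Prop :=
  (forall A B, bivector A -> bivector B ->
     inner2 G (T A) B = inner2 G A (T B)) /\
  (forall A, bivector A -> A != 0 -> 0 < inner2 G (T A) A).

(* As bivectors of the form [wedge x y] span Lambda^2, the operators [Rop] and
   [Wop] are determined on bivectors by [riemann g p] and [omega]. *)
Definition strongly_positive (R : realType) (n : nat) (M : manifold R n)
    (g : metric M) : Prop :=
  forall p : M,
  exists omega : 'rV[R]_n -> 'rV[R]_n -> 'rV[R]_n -> 'rV[R]_n -> R,
  exists Rop Wop : {linear 'M[R]_n -> 'M[R]_n},
  [/\ alternating4 omega,
      operator_of (gram g p) (riemann g p) Rop,
      operator_of (gram g p) omega Wop
    & positive_definite (gram g p) (fun A => Rop A + Wop A)].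

Lemma innerE (R : realType) (n : nat) (G : 'M[R]_n) (u v : 'rV[R]_n) :
  inner G u v = \sum_(i < n) \sum_(j < n) u 0 i * G i j * v 0 j.
Proof.
rewrite /inner mxE exchange_big /=; apply: eq_bigr => j _.
by rewrite mxE [v^T _ _]mxE mulr_suml.
Qed.

Lemma inner_sym (R : realType) (n : nat) (G : 'M[R]_n) (u v : 'rV[R]_n) :
  G^T = G -> inner G u v = inner G v u.
Proof.
move=> symG; rewrite !innerE exchange_big /=; apply: eq_bigr => i _.
apply: eq_bigr => j _; have -> : G j i = G i j by rewrite -{1}symG mxE.
by ring.
Qed.

Lemma inner2_wedge (R : realType) (n : nat) (G : 'M[R]_n)
    (x y z w : 'rV[R]_n) :
  G^T = G ->
  inner2 G (wedge x y) (wedge z w) =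
  inner G x z * inner G y w - inner G x w * inner G y z.
Proof.
move=> symG.
have innerC u v := inner_sym u v symG.
have tr4 a b c d : \tr (G *m (a^T *m b) *m G *m (c^T *m d)) =
    inner G b c * inner G d a.
  have -> : G *m (a^T *m b) *m G *m (c^T *m d) =
    (G *m a^T) *m (b *m G *m c^T *m d) by rewrite !mulmxA.
  rewrite mxtrace_mulC.
  have -> : b *m G *m c^T *m d *m (G *m a^T) =
    (b *m G *m c^T) *m (d *m G *m a^T) by rewrite !mulmxA.
  by rewrite trace_mx11 mxE big_ord1.
rewrite /inner2 /wedge [(_ - _)^T]raddfB /= !trmx_mul !trmxK.
rewrite mulmxBr (mulmxBr G) !mulmxBl !(raddfB mxtrace) /= !tr4.
rewrite (innerC z x) (innerC z y) (innerC w x) (innerC w y).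
by field.
Qed.

Lemma derive_gram_sym (R : realType) (n : nat) (G : 'rV[R]_n -> 'M[R]_n)
    (x v : 'rV[R]_n) :
  (\forall y \near x, (G y)^T = G y) -> differentiable G x ->
  ('D_v G x)^T = 'D_v G x.
Proof.
move=> symG dG; have Gv : derivable G x v by exact: diff_derivable.
have [->|v0] := eqVneq v 0; first by rewrite derive0 trmx0.
rewrite derive_mx//; apply/matrixP => i j; rewrite !mxE.
apply: near_eq_derive => //.
by apply: filterS symG => y Gy; rewrite -[in LHS]Gy mxE.
Qed.

Lemma christoffelC (R : realType) (n : nat) (G : 'rV[R]_n -> 'M[R]_n)
    (x u v : 'rV[R]_n) :
  (\forall y \near x, (G y)^T = G y) -> differentiable G x ->
  christoffel G x u v = christoffel G x v u.
Proof.
move=> symG dG; rewrite /christoffel; congr (_ *m _); congr (_ *: _).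
apply/rowP => k; rewrite [LHS]mxE [RHS]mxE.
move: (derive_gram_sym (delta_mx 0 k) symG dG).
move: ('D_u G x) ('D_v G x) ('D_(delta_mx 0 k) G x) => Du Dv De symDe.
by rewrite (inner_sym u v symDe) [inner Du _ _ + _]addrC.
Qed.

Lemma nabla_torsion_free (R : realType) (n : nat) (G : 'rV[R]_n -> 'M[R]_n)
    (X Y : 'rV[R]_n -> 'rV[R]_n) (x : 'rV[R]_n) :
  (\forall y \near x, (G y)^T = G y) -> differentiable G x ->
  nabla G X Y x - nabla G Y X x = bracket X Y x.
Proof.
move=> symG dG.
by rewrite /nabla /bracket (christoffelC _ _ symG dG) opprD addrACA subrr addr0.
Qed.

Lemma inner_christoffel (R : realType) (n : nat) (G : 'rV[R]_n -> 'M[R]_n)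
    (x u v w : 'rV[R]_n) :
  G x \in unitmx -> differentiable G x ->
  inner (G x) (christoffel G x u v) w =
  2^-1 * (inner ('D_u G x) v w + inner ('D_v G x) u w - inner ('D_w G x) u v).
Proof.
move=> Gu dG; rewrite [LHS]/inner /christoffel mulmxKV// -scalemxAl [LHS]mxE.
congr (_ * _).
have Dw b c : inner ('D_w G x) b c =
    \sum_k w 0 k * inner ('D_(delta_mx 0 k) G x) b c.
  rewrite /inner [in LHS](row_sum_delta w) deriveE// linear_sum /=.
  rewrite mulmx_sumr mulmx_suml summxE; apply: eq_bigr => k _.
  by rewrite linearZ /= -deriveE// -scalemxAr -scalemxAl mxE.
have innerw A a : inner A a w = \sum_k w 0 k * inner A a (delta_mx 0 k).
  rewrite /inner [in LHS](row_sum_delta w) linear_sum /= mulmx_sumr summxE.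
  by apply: eq_bigr => k _; rewrite linearZ /= -scalemxAr mxE.
rewrite [LHS]mxE.
move: (Dw u v); move: ('D_u G x) ('D_v G x) ('D_w G x) => Du Dv D ->.
rewrite (innerw Du) (innerw Dv).
rewrite -big_split -sumrB /=.
by apply: eq_bigr => k _; rewrite mxE [w^T _ _]mxE mulrC mulrBr mulrDr.
Qed.

Lemma derive_inner (R : realType) (n : nat) (G : 'rV[R]_n -> 'M[R]_n)
    (X Y : 'rV[R]_n -> 'rV[R]_n) (x v : 'rV[R]_n) :
  differentiable G x -> differentiable X x -> differentiable Y x ->
  'D_v (fun y => inner (G y) (X y) (Y y)) x =
  inner ('D_v G x) (X x) (Y x) + inner (G x) ('D_v X x) (Y x)
  + inner (G x) (X x) ('D_v Y x).
Proof.
move=> diffG diffX diffY.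
have dG : derivable G x v by exact: diff_derivable.
have dX : derivable X x v by exact: diff_derivable.
have dY : derivable Y x v by exact: diff_derivable.
move: (derive_mx dG) (derive_mx dX) (derive_mx dY).
move: ('D_v G x) ('D_v X x) ('D_v Y x) => DG DX DY -> -> ->.
have dGe i j := (derivable_mxP G x v).1 dG i j.
have dXe i j := (derivable_mxP X x v).1 dX i j.
have dYe i j := (derivable_mxP Y x v).1 dY i j.
have -> : (fun y => inner (G y) (X y) (Y y)) =
  \sum_(i < n) \sum_(j < n) ((fun y => X y 0 i) * (fun y => G y i j)
                             * (fun y => Y y 0 j)).
  apply/funext => y; rewrite innerE fct_sumE; apply: eq_bigr => i _.
  by rewrite fct_sumE; apply: eq_bigr => j _.
have d3 i j : derivable ((fun y => X y 0 i) * (fun y => G y i j)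
    * (fun y => Y y 0 j)) x v.
  by apply: derivableM => //; apply: derivableM.
rewrite derive_sum; last by move=> i; apply: derivable_sum.
rewrite !innerE -!big_split /=; apply: eq_bigr => i _.
rewrite derive_sum// -!big_split /=; apply: eq_bigr => j _.
rewrite (deriveM (derivableM (dXe 0 i) (dGe i j)) (dYe 0 j)).
rewrite (deriveM (dXe 0 i) (dGe i j)) !mxE /=.
rewrite /GRing.scale /= (_ : (_ * _) x = X x 0 i * G x i j)//.
move: (X x 0 i) (Y x 0 j) (G x i j) => a b c.
move: ('D_v _ x : R) ('D_v _ x : R) ('D_v _ x : R) => a' b' c'.
by ring.
Qed.

Lemma nabla_metric (R : realType) (n : nat) (G : 'rV[R]_n -> 'M[R]_n)
    (X Y Z : 'rV[R]_n -> 'rV[R]_n) (x : 'rV[R]_n) :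
  (\forall y \near x, (G y)^T = G y) -> G x \in unitmx ->
  differentiable G x -> differentiable X x -> differentiable Y x ->
  'D_(Z x) (fun y => inner (G y) (X y) (Y y)) x =
  inner (G x) (nabla G Z X x) (Y x) + inner (G x) (X x) (nabla G Z Y x).
Proof.
move=> symG Gu dG dX dY; rewrite derive_inner//.
have symGx : (G x)^T = G x by exact: nbhs_singleton symG.
have innerDl u v w : inner (G x) (u + v) w = inner (G x) u w + inner (G x) v w.
  by rewrite /inner !mulmxDl mxE.
rewrite (inner_sym (X x) (nabla _ _ _ _) symGx) /nabla !innerDl.
rewrite (inner_sym ('D_(Z x) Y x) _ symGx) !inner_christoffel//.
move: (derive_gram_sym (Z x) symG dG).
move: ('D_(Z x) G x) ('D_(X x) G x) ('D_(Y x) G x) => GZ GX GY symGZ.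
rewrite (inner_sym (Y x) (X x) symGZ).
move: ('D_(Z x) X x) ('D_(Z x) Y x) => DX DY.
by field.
Qed.

(* Main.v *)
(* The theorem is O'Neill's formula read on Lambda^2. With A the O'Neill tensor
   of the submersion and a(X,Y,Z,W) = <A_X Y, A_Z W> on horizontal lifts, the
   curvature of the base is Rbar + 3 a minus the cyclic sum of a in its first
   three arguments, and this cyclic sum is a 4-form. If Rbar + omega is positive
   definite upstairs, then adding to the curvature of the base the restriction
   of omega to horizontal vectors plus that cyclic sum leaves
   (Rbar + omega) + 3 a, where a, being <A* A ., .>, is positive semidefinite.

   O'Neill's formula is obtained in coordinates, without vector fields. The
   metric upstairs is h + k, where h is the pullback of the metric of the base
   and k (below, [vertical]) vanishes on horizontal vectors. Christoffel symbols
   of the first kind are additive in the metric. The h-terms give the curvature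
   of the base, and since k = k L k with L the inverse metric upstairs, the
   second derivatives of k on horizontal vectors are products of first
   derivatives, which are the components of A. *)
From HB Require Import structures.
From mathcomp Require Import all_boot all_order all_algebra ring.
From mathcomp Require Import all_classical all_reals all_analysis.
Require Import Defs.
Set Implicit Arguments.
Unset Strict Implicit.
Unset Printing Implicit Defensive.
Import Order.TTheory GRing.Theory Num.Theory numFieldNormedType.Exports.
Local Open Scope classical_set_scope.
Local Open Scope ring_scope.

(** * Calculus of smooth matrix-valued functions *)

(** A textbook proof extends horizontal vectors to basic fields. Here the curvature is taken on
    fields that are constant in a chart, and a constant field horizontal at one point need not be so
    nearby. Horizontality is therefore used only at a point, as [u *m vertical p = 0], and what gets
    differentiated is [k = k L k], an identity on an open set. Next to a horizontal vector a factor
    [k] vanishes at the point, so of two derivatives one must fall on each [k], and the derivatives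
    of [L] drop out.

    The pullback [h] is degenerate along the fibres and so has no Christoffel symbols of the second
    kind. Two devices replace them: metric compatibility writes the curvature with derivatives of
    first-kind symbols only, and in the remaining quadratic terms the Hessian of the submersion
    stands for the raised symbols. These terms split without mixed products, because covectors
    pulled back from the base are orthogonal to those that annihilate horizontal vectors.

    Only the skew part of the first derivative of [k] is tensorial; its symmetric part depends on
    the coordinates and has to cancel. *)

Lemma near_eq_is_diff (R : realType) (V W : normedModType R)
    (f g : V -> W) (x : V) :
  {near x, f =1 g} -> differentiable f x -> is_diff x g ('d f x).
Proof.
move=> fg df.
have gdf : g \o shift x = cst (g x) + 'd f x +o_ 0 id.
  apply/eqaddoP => e e0.
  have /eqaddoP /(_ e e0) fo := diff_locally df.
  have fg0 : \forall h \near 0, f (h + x) = g (h + x).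
    have : \forall y \near x, f y = g y by [].
    by rewrite (near_shift 0) /= subr0.
  apply: filterS2 fo fg0 => h /=; rewrite /= !fctE /= => + <-.
  by rewrite (nbhs_singleton fg).
have dge : 'd g x = 'd f x :> (V -> W).
  by apply: diff_unique gdf; exact: diff_continuous.
split=> //; apply/diff_locallyP; rewrite dge; split=> //.
exact: diff_continuous.
Qed.

Lemma near_eq_differentiable (R : realType) (V W : normedModType R)
    (f g : V -> W) (x : V) :
  {near x, f =1 g} -> differentiable f x -> differentiable g x.
Proof. by move=> fg /(near_eq_is_diff fg) []. Qed.

Lemma differentiable_entries (R : realType) (V : normedModType R) (m n : nat)
    (A : V -> 'M[R]_(m, n)) (x : V) :
  (forall i j, differentiable (fun y => A y i j) x) -> differentiable A x.
Proof.
move=> dA.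
have -> : A = \sum_(i < m) \sum_(j < n) (fun y => A y i j *: delta_mx i j).
  apply/funext => y; rewrite fct_sumE [LHS]matrix_sum_delta.
  by apply: eq_bigr => i _; rewrite fct_sumE.
apply: differentiable_sum => i; apply: differentiable_sum => j.
exact: differentiableZl.
Qed.

Lemma differentiable_entry (R : realType) (V : normedModType R) (m n : nat)
    (A : V -> 'M[R]_(m, n)) (x : V) i j :
  differentiable A x -> differentiable (fun y => A y i j) x.
Proof.
move=> dA.
exact: (differentiable_comp dA (differentiable_coord (A x) i j)).
Qed.

Lemma differentiable_mulmx (R : realType) (V : normedModType R) (m n p : nat)
    (A : V -> 'M[R]_(m, n)) (B : V -> 'M[R]_(n, p)) (x : V) :
  differentiable A x -> differentiable B x ->
  differentiable (fun y => A y *m B y) x.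
Proof.
move=> dA dB; apply: differentiable_entries => i j.
have -> : (fun y => (A y *m B y) i j) =
    \sum_(k < n) ((fun y => A y i k) * (fun y => B y k j)).
  by apply/funext => y; rewrite mxE fct_sumE.
by apply: differentiable_sum => k; apply: differentiableM;
  apply: differentiable_entry.
Qed.

Lemma smooth_differentiable (R : realType) (V W : normedModType R) (U : set V)
    (f : V -> W) (x : V) : smooth_on U f -> U x -> differentiable f x.
Proof. by move=> /(_ 1%N)[df _]; exact: df. Qed.

Lemma smooth_derive (R : realType) (V W : normedModType R) (U : set V)
    (f : V -> W) (v : V) : smooth_on U f -> smooth_on U ('D_v f).
Proof. by move=> sf k; have [_] := sf k.+1; apply. Qed.

(* Unlike [Ck_on], which starts from continuity, this starts from nothing, so
   that inductions on [k] only have to deal with derivatives. *)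
Fixpoint diff_upto (R : realType) (V W : normedModType R) (k : nat) (U : set V)
    (f : V -> W) : Prop :=
  match k with
  | 0%N => True
  | k'.+1 => (forall x, U x -> differentiable f x) /\
             (forall v, diff_upto k' U ('D_v f))
  end.

Lemma smooth_onP (R : realType) (V W : normedModType R) (U : set V)
    (f : V -> W) : smooth_on U f <-> forall k, diff_upto k U f.
Proof.
split=> [sf k|df k]; last first.
  elim: k f df => [|k IHk] f df /=.
    by move=> x Ux; apply: differentiable_continuous; have [+ _] := df 1%N;
      apply.
  split=> [x Ux|v]; first by have [+ _] := df 1%N; apply.
  by apply: IHk => l; have [_] := df l.+1; apply.
elim: k f sf => [//|k IHk] f sf; split=> [x|v].
  exact: smooth_differentiable.
by apply: IHk; exact: smooth_derive.
Qed.

Lemma diff_upto_weak (R : realType) (V W : normedModType R) (k : nat)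
    (U : set V) (f : V -> W) : diff_upto k.+1 U f -> diff_upto k U f.
Proof.
elim: k f => [//|k IHk] f [df ddf]; split=> // v; apply: IHk; exact: ddf.
Qed.

Lemma diff_upto_eq (R : realType) (V W : normedModType R) (k : nat)
    (U : set V) (f g : V -> W) :
  open U -> (forall x, U x -> f x = g x) -> diff_upto k U f -> diff_upto k U g.
Proof.
move=> oU; elim: k f g => [//|k IHk] f g fg [df ddf].
have nfg x : U x -> \forall y \near x, f y = g y.
  by move=> Ux; apply: filterS fg _; exact: open_nbhs_nbhs.
split=> [x Ux|v]; first by apply: near_eq_differentiable (df x Ux); exact: nfg.
apply: (IHk ('D_v f)) => [x Ux|]; last exact: ddf.
by apply: near_eq_derive; exact: nfg.
Qed.

Lemma diff_upto_cst (R : realType) (V W : normedModType R) (k : nat)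
    (U : set V) (c : W) : diff_upto k U (cst c : V -> W).
Proof.
elim: k c => [//|k IHk] c; split=> [x _|v]; first exact: differentiable_cst.
by rewrite (_ : 'D_v (cst c) = cst 0) //; apply/funext => x; exact: derive_cst.
Qed.

Lemma diff_uptoD (R : realType) (V W : normedModType R) (k : nat)
    (U : set V) (f g : V -> W) :
  open U -> diff_upto k U f -> diff_upto k U g -> diff_upto k U (f + g).
Proof.
move=> oU; elim: k f g => [//|k IHk] f g [df ddf] [dg ddg].
split=> [x Ux|v]; first exact: differentiableD (df x Ux) (dg x Ux).
apply: (@diff_upto_eq _ _ _ _ _ ('D_v f + 'D_v g)) => // [x Ux|].
  by rewrite deriveD//; apply: diff_derivable; [exact: df | exact: dg].
by apply: IHk; [exact: ddf | exact: ddg].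
Qed.

Lemma diff_uptoM (R : realType) (V : normedModType R) (k : nat)
    (U : set V) (f g : V -> R) :
  open U -> diff_upto k U f -> diff_upto k U g -> diff_upto k U (f * g).
Proof.
move=> oU; elim: k f g => [//|k IHk] f g f_upto g_upto.
(* The product rule leaves one factor undifferentiated, so both factors are also needed at order
   [k]. *)
have f_weak := diff_upto_weak f_upto; have g_weak := diff_upto_weak g_upto.
move: f_upto g_upto => [df ddf] [dg ddg].
split=> [x Ux|v]; first exact: differentiableM (df x Ux) (dg x Ux).
apply: (@diff_upto_eq _ _ _ _ _ (f * 'D_v g + g * 'D_v f)) => // [x Ux|].
  by rewrite deriveM//; apply: diff_derivable; [exact: df | exact: dg].
by apply: diff_uptoD => //; apply: IHk => //; [exact: ddg | exact: ddf].
Qed.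

Lemma diff_uptoV (R : realType) (V : normedModType R) (k : nat)
    (U : set V) (f : V -> R) :
  open U -> (forall x, U x -> f x != 0) -> diff_upto k U f ->
  diff_upto k U (fun x => (f x)^-1).
Proof.
move=> oU f0; elim: k => [//|k IHk] f_upto.
have f_weak := diff_upto_weak f_upto; move: f_upto => [df ddf].
split=> [x Ux|v]; first exact: differentiableV (df x Ux) (f0 x Ux).
pose g x := (f x)^-1.
(* The derivative is expressed through [1 / f] itself, to which the induction hypothesis applies at
   order [k]. *)
apply: (@diff_upto_eq _ _ _ _ _ (cst (-1) * (g * g * 'D_v f))) => // [x Ux|].
  rewrite deriveV//; last by apply: diff_derivable; exact: df.
    by rewrite /GRing.scale /= !fctE /= /g -exprVn expr2 mulN1r mulNr.
  exact: f0.
have ? := IHk f_weak.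
apply: diff_uptoM => //; first exact: diff_upto_cst.
by apply: diff_uptoM => //; [exact: diff_uptoM | exact: ddf].
Qed.

Lemma diff_upto_sum (R : realType) (V W : normedModType R) (k : nat)
    (U : set V) (I : Type) (r : seq I) (f : I -> V -> W) :
  open U -> (forall i, diff_upto k U (f i)) ->
  diff_upto k U (fun x => \sum_(i <- r) f i x).
Proof.
move=> oU df; elim: r => [|i r IHr].
  under eq_fun do rewrite big_nil.
  exact: diff_upto_cst.
under eq_fun do rewrite big_cons.
exact: diff_uptoD.
Qed.

Lemma diff_upto_prod (R : realType) (V : normedModType R) (k : nat)
    (U : set V) (I : Type) (r : seq I) (f : I -> V -> R) :
  open U -> (forall i, diff_upto k U (f i)) ->
  diff_upto k U (fun x => \prod_(i <- r) f i x).
Proof.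
move=> oU df; elim: r => [|i r IHr].
  under eq_fun do rewrite big_nil.
  exact: diff_upto_cst.
under eq_fun do rewrite big_cons.
exact: diff_uptoM.
Qed.

Lemma diff_upto_entries (R : realType) (V : normedModType R) (k m n : nat)
    (U : set V) (A : V -> 'M[R]_(m, n)) : open U ->
  diff_upto k U A <-> forall i j, diff_upto k U (fun x => A x i j).
Proof.
move=> oU.
have DE (B : V -> 'M[R]_(m, n)) (v x : V) i j : differentiable B x ->
    'D_v B x i j = 'D_v (fun y => B y i j) x :> R.
  move=> dB; rewrite derive_mx ?mxE//; exact: diff_derivable.
elim: k A => [//|k IHk] A; split=> [[dA ddA] i j|dA].
  split=> [x Ux|v]; first exact: differentiable_entry (dA x Ux).
  apply: (@diff_upto_eq _ _ _ _ _ (fun x => 'D_v A x i j)) => // [x Ux|].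
    by rewrite DE//; exact: dA.
  by move: i j; apply/IHk; exact: ddA.
have dA1 x : U x -> differentiable A x.
  by move=> Ux; apply: differentiable_entries => i j; have [+ _] := dA i j;
    apply.
split=> // v; apply/IHk => i j.
apply: (@diff_upto_eq _ _ _ _ _ ('D_v (fun x => A x i j))) => // [x Ux|].
  by rewrite DE//; exact: dA1.
by have [_] := dA i j; apply.
Qed.

(** In coordinates the chain rule involves only the compositions ['D_(delta_mx 0 i) g \o f], which
    have the same inner map; hence the induction varies [g] and keeps [f] fixed. *)
Lemma diff_upto_comp (R : realType) (V : normedModType R) (k n : nat)
    (U : set V) (W : set 'rV[R]_n) (f : V -> 'rV[R]_n) (g : 'rV[R]_n -> R) :
  open U -> (forall x, U x -> W (f x)) ->
  diff_upto k U f -> diff_upto k W g -> diff_upto k U (g \o f).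
Proof.
move=> oU UW; elim: k g => [//|k IHk] g f_upto g_upto.
have f_weak := diff_upto_weak f_upto.
move: f_upto g_upto => [df ddf] [dg ddg].
split=> [x Ux|v]; first exact: differentiable_comp (df x Ux) (dg _ (UW x Ux)).
apply: (@diff_upto_eq _ _ _ _ _ (fun x => \sum_(i < n)
   ((fun y => 'D_v f y 0 i) * ('D_(delta_mx 0 i) g \o f)) x)) => // [x Ux|].
  rewrite deriveE; last exact: differentiable_comp (df x Ux) (dg _ (UW x Ux)).
  rewrite diff_comp; [|exact: df|exact/dg/UW].
  rewrite /= -(deriveE _ (df x Ux)) [in RHS](row_sum_delta
    ('D_v f x)) linear_sum /=.
  by apply: eq_bigr => i _; rewrite linearZ /= -deriveE//; exact/dg/UW.
apply: diff_upto_sum => // i; apply: diff_uptoM => //.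
  by move: i; move: (0 : 'I_1); apply/diff_upto_entries => //; exact: ddf.
by apply: IHk => //; exact: ddg.
Qed.

Lemma smooth_on_entries (R : realType) (V : normedModType R) (m n : nat)
    (U : set V) (A : V -> 'M[R]_(m, n)) : open U ->
  smooth_on U A <-> forall i j, smooth_on U (fun x => A x i j).
Proof.
move=> oU; split=> [/smooth_onP sA i j|sA].
  by apply/smooth_onP => k; move: i j; apply/diff_upto_entries.
apply/smooth_onP => k; apply/diff_upto_entries => // i j.
by move: k; apply/smooth_onP; exact: sA.
Qed.

Lemma smooth_on_cst (R : realType) (V W : normedModType R) (U : set V) (c : W) :
  smooth_on U (cst c : V -> W).
Proof. by apply/smooth_onP => k; exact: diff_upto_cst. Qed.

Lemma smooth_onD (R : realType) (V W : normedModType R) (U : set V)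
    (f g : V -> W) :
  open U -> smooth_on U f -> smooth_on U g -> smooth_on U (fun x => f x + g x).
Proof.
move=> oU /smooth_onP sf /smooth_onP sg.
by apply/smooth_onP => k; exact: diff_uptoD.
Qed.

Lemma smooth_onM (R : realType) (V : normedModType R) (U : set V)
    (f g : V -> R) :
  open U -> smooth_on U f -> smooth_on U g -> smooth_on U (fun x => f x * g x).
Proof.
move=> oU /smooth_onP sf /smooth_onP sg.
by apply/smooth_onP => k; exact: diff_uptoM.
Qed.

Lemma smooth_on_mulmx (R : realType) (V : normedModType R) (m n p : nat)
    (U : set V) (A : V -> 'M[R]_(m, n)) (B : V -> 'M[R]_(n, p)) : open U ->
  smooth_on U A -> smooth_on U B -> smooth_on U (fun x => A x *m B x).
Proof.
move=> oU /(smooth_on_entries _ oU) sA /(smooth_on_entries _ oU) sB.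
apply/smooth_on_entries => // i j; under eq_fun do rewrite mxE.
apply/smooth_onP => k; apply: diff_upto_sum => // l; move: k; apply/smooth_onP.
exact: smooth_onM.
Qed.

Lemma smooth_on_trmx (R : realType) (V : normedModType R) (m n : nat)
    (U : set V) (A : V -> 'M[R]_(m, n)) : open U ->
  smooth_on U A -> smooth_on U (fun x => (A x)^T).
Proof.
move=> oU /(smooth_on_entries _ oU) sA.
apply/smooth_on_entries => // i j; under eq_fun do rewrite mxE.
exact: sA.
Qed.

Lemma smooth_onNmx (R : realType) (V : normedModType R) (m n : nat)
    (U : set V) (A : V -> 'M[R]_(m, n)) : open U ->
  smooth_on U A -> smooth_on U (fun x => - A x).
Proof.
move=> oU sA; have -> : (fun x => - A x) = fun x => (- 1%:M) *m A x.
  by apply/funext => x; rewrite mulNmx mul1mx.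
by apply: smooth_on_mulmx => //; exact: smooth_on_cst.
Qed.

Lemma smooth_on_det (R : realType) (V : normedModType R) (n : nat)
    (U : set V) (A : V -> 'M[R]_n) : open U ->
  smooth_on U A -> smooth_on U (fun x => \det (A x)).
Proof.
move=> oU /(smooth_on_entries _ oU) sA; apply/smooth_onP => k.
apply: diff_upto_sum => // s; apply: diff_uptoM => //;
  first exact: diff_upto_cst.
by apply: diff_upto_prod => // i; move: k; apply/smooth_onP.
Qed.

(** Cramer's rule: each entry is a cofactor divided by a determinant that does not vanish on [U]. *)
Lemma smooth_on_invmx (R : realType) (V : normedModType R) (n : nat)
    (U : set V) (A : V -> 'M[R]_n) : open U ->
  (forall x, U x -> A x \in unitmx) ->
  smooth_on U A -> smooth_on U (fun x => invmx (A x)).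
Proof.
move=> oU uA sA; apply/smooth_on_entries => // i j; apply/smooth_onP => k.
apply: (@diff_upto_eq _ _ _ _ _
    ((fun x => (\det (A x))^-1) * (fun x => cofactor (A x) j i))) => // [x Ux|].
  by rewrite /invmx uA// !mxE.
apply: diff_uptoM => //.
  apply: diff_uptoV => // [x /uA|]; first by rewrite unitmxE unitfE.
  by move: k; apply/smooth_onP; exact: smooth_on_det.
move: k; apply/smooth_onP; apply: smooth_onM => //; first exact: smooth_on_cst.
apply: smooth_on_det => //; apply/smooth_on_entries => // l l'.
under eq_fun do rewrite !mxE.
by have /(smooth_on_entries _ oU) := sA; apply.
Qed.

Lemma smooth_on_comp (R : realType) (V : normedModType R) (m n p : nat)
    (U : set V) (W : set 'rV[R]_n) (f : V -> 'rV[R]_n)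
    (g : 'rV[R]_n -> 'M[R]_(m, p)) :
  open U -> open W -> (forall x, U x -> W (f x)) ->
  smooth_on U f -> smooth_on W g -> smooth_on U (fun x => g (f x)).
Proof.
move=> oU oW UW /smooth_onP sf /(smooth_on_entries _ oW) sg.
apply/smooth_on_entries => // i j; apply/smooth_onP => k.
apply: (diff_upto_comp (g := fun y => g y i j) oU UW); first exact: sf.
by move: k; apply/smooth_onP; exact: sg.
Qed.

(** * Symmetry of second derivatives *)

Lemma is_derive_line (R : realType) (V W : normedModType R) (f : V -> W)
    (x u : V) (s : R) :
  derivable f (x + s *: u) u ->
  is_derive s 1 (fun t : R => f (x + t *: u)) ('D_u f (x + s *: u)).
Proof.
have E : (fun h : R =>
      h^-1 *: (((fun t : R => f (x + t *: u)) \o shift s) (h *: 1)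
      - f (x + s *: u))) =
    (fun h : R =>
      h^-1 *: ((f \o shift (x + s *: u)) (h *: u) - f (x + s *: u))).
  apply/funext => h /=; congr (_ *: (f _ - _)).
  by rewrite [h *: 1]mulr1 scalerDl addrCA.
by move=> df; split; rewrite /derivable /derive E.
Qed.

(** The mean value theorem along [u], applied to the increment in direction [v], turns the second
    difference into a difference of values of ['D_u f]; both values are then expanded to first order
    at [x]. No continuity of second derivatives enters. *)
Lemma second_difference (R : realType) (V : normedModType R) (f : V -> R)
    (x u v : V) (e : R) :
  (\forall y \near x, differentiable f y) -> differentiable ('D_u f) x ->
  0 < e ->
  exists2 d, 0 < d & forall h : R, 0 < h -> h < d ->
    `|f (x + h *: v + h *: u) - f (x + h *: u) - f (x + h *: v) + f x
      - h ^+ 2 * 'D_v ('D_u f) x| <= h ^+ 2 * e.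
Proof.
move=> /nbhs_ballP[r /= r0 df] ddf e0.
(* The two first-order remainders are controlled by [h * |u|] and [h * (|v| + |u|)]; the [1] makes
   [c] positive. *)
pose c : R := `|u| + `|v| + `|u| + 1.
have c0 : 0 < c by rewrite ltr_wpDl// !addr_ge0.
have ec : 0 < e / c by rewrite divr_gt0.
have := diff_locally ddf => /eqaddoP /(_ _ ec) /nbhs_ballP[r' /= r'0 Ddf].
have small k (h t w : R) : 0 < h -> h < k / c -> 0 <= t <= h -> 0 <= w <= h ->
    `|w *: v + t *: u| < k.
  move=> h0 hk /andP[t0 th] /andP[w0 wh]; apply: (@le_lt_trans _ _ (h * c)).
    rewrite (le_trans (ler_normD _ _))// !normrZ (ger0_norm t0) (ger0_norm w0).
    rewrite addrC /c -!addrA mulrDr lerD ?ler_wpM2r//.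
    rewrite mulrDr -[leLHS]addr0 lerD ?ler_wpM2r//.
    by rewrite mulr_ge0// ?addr_ge0// ltW.
  by rewrite -ltr_pdivlMr.
exists (Num.min (r / c) (r' / c)); first by rewrite lt_min !divr_gt0.
move=> h h0; rewrite lt_min => /andP[hr hr'].
have dfa (t w : R) : 0 <= t <= h -> 0 <= w <= h ->
    differentiable f (x + w *: v + t *: u).
  move=> th wh; apply: df; rewrite -ball_normE /=.
  by rewrite -addrA opprD addNKr normrN; exact: small hr th wh.
have Ddfa (t w : R) : 0 <= t <= h -> 0 <= w <= h ->
    `|'D_u f (x + w *: v + t *: u)
      - ('D_u f x + 'd ('D_u f) x (w *: v + t *: u))|
    <= e / c * `|w *: v + t *: u|.
  move=> th wh; have := Ddf (w *: v + t *: u).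
  have -> : x + w *: v + t *: u = (w *: v + t *: u) + x by rewrite -addrA addrC.
  rewrite /= !fctE /=; apply.
  by rewrite -ball_normE /= sub0r normrN; exact: small hr' th wh.
(* The second difference is [phi h - phi 0]. Keeping [0 *: v] gives both terms the shape treated by
   [dfa] and [Ddfa], with [w] equal to [h] and to [0]. *)
pose phi (t : R) : R := f (x + h *: v + t *: u) - f (x + 0 *: v + t *: u).
pose dphi (t : R) : R :=
  'D_u f (x + h *: v + t *: u) - 'D_u f (x + 0 *: v + t *: u).
have hh : 0 <= h <= h by rewrite ltW /=.
have h00 : (0:R) <= 0 <= h by rewrite lexx ltW.
have dphiP t : 0 <= t <= h -> is_derive t 1 phi (dphi t).
  move=> th; apply: is_deriveB; apply: is_derive_line;
    apply: diff_derivable; exact: dfa.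
have [||t] := @MVT _ phi dphi 0 h h0.
- move=> t; rewrite in_itv /= => /andP[t0 th].
  by apply: dphiP; rewrite !ltW.
- apply: derivable_within_continuous => t; rewrite in_itv /= => th.
  by have [] := dphiP t th.
rewrite in_itv /= => /andP[t0 th].
have t0h : 0 <= t <= h by rewrite !ltW.
rewrite /phi scale0r !addr0 scale0r !addr0 subr0 opprB addrA addrAC.
move=> ->.
have LE w : 'd ('D_u f) x (w *: v + t *: u) =
    w * 'D_v ('D_u f) x + t * 'D_u ('D_u f) x :> R.
  by rewrite linearD !linearZ /= !deriveE.
have := Ddfa t 0 t0h h00; have := Ddfa t h t0h hh; rewrite !LE /dphi.
move: ('D_u f (_ + h *: v + _)) ('D_u f (_ + 0 *: v + _)) ('D_u f x)
  ('D_v ('D_u f) x) ('D_u ('D_u f) x).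
move=> A B C Lv Lu hA hB.
have -> : (A - B) * h - h ^+ 2 * Lv =
  h * ((A - (C + (h * Lv + t * Lu))) -
       (B - (C + (0 * Lv + t * Lu)))) by ring.
rewrite normrM gtr0_norm// expr2 -mulrA ler_pM2l//.
rewrite (le_trans (ler_normB _ _))// (le_trans (lerD hA hB))//.
rewrite -mulrDr mulrAC ler_pdivrMr// (mulrC h) -mulrA ler_pM2l//.
have tu : `|t *: u| <= h * `|u|.
  by rewrite normrZ gtr0_norm// ler_wpM2r// ltW.
have hv : `|h *: v| <= h * `|v| by rewrite normrZ gtr0_norm.
rewrite scale0r add0r /c !mulrDr mulr1 -[leLHS]addr0 lerD ?(ltW h0)//.
rewrite lerD// (le_trans (ler_normD _ _))// addrC lerD//.
Qed.

(** The second difference is symmetric in [u] and [v], so one quotient by [h ^+ 2] approximates both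
    iterated derivatives. *)
Lemma derive_swap (R : realType) (V : normedModType R) (f : V -> R)
    (x u v : V) :
  (\forall y \near x, differentiable f y) ->
  differentiable ('D_u f) x -> differentiable ('D_v f) x ->
  'D_v ('D_u f) x = 'D_u ('D_v f) x.
Proof.
move=> df du dv; apply/eqP; rewrite -subr_eq0 -normr_le0.
apply/ler_addgt0Pr => e e0; rewrite add0r.
have e2 : 0 < e / 2 by rewrite divr_gt0.
have [d d0 Hd] := second_difference v df du e2.
have [d' d'0 Hd'] := second_difference u df dv e2.
pose h := Num.min d d' / 2.
have h0 : 0 < h by rewrite divr_gt0// lt_min d0.
have [hd hd'] : h < d /\ h < d'.
  have: h < Num.min d d' by rewrite ltr_pdivrMr// ltr_pMr ?lt_min ?d0// ltr1n.
  by rewrite lt_min => /andP[].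
have := Hd h h0 hd; have := Hd' h h0 hd'.
rewrite [x + h *: u + h *: v]addrAC.
set P := f _; set Q := f _; set S := f _; set a := 'D_u _ x; set b := 'D_v _ x.
move=> Ha Hb; have h2 : 0 < h ^+ 2 by rewrite exprn_gt0.
rewrite -(ler_pM2l h2) -[X in X * _](gtr0_norm h2) -normrM.
have -> : h ^+ 2 * (b - a) = (P - Q - S + f x - h ^+ 2 * a) -
   (P - S - Q + f x - h ^+ 2 * b) by ring.
rewrite (le_trans (ler_normB _ _))// (le_trans (lerD Ha Hb))//.
by rewrite -mulrDr -splitr.
Qed.

Lemma derive_swap_mx (R : realType) (V : normedModType R) (m n : nat)
    (f : V -> 'M[R]_(m, n)) (x u v : V) :
  (\forall y \near x, differentiable f y) ->
  (\forall y \near x, differentiable ('D_u f) y) ->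
  (\forall y \near x, differentiable ('D_v f) y) ->
  'D_v ('D_u f) x = 'D_u ('D_v f) x.
Proof.
move=> df ddu ddv; have du := nbhs_singleton ddu; have dv := nbhs_singleton ddv.
have E w i j : {near x, (fun y => 'D_w f y i j) =1 'D_w (fun y => f y i j)}.
  apply: filterS df => y dfy; rewrite derive_mx ?mxE//; exact: diff_derivable.
have dE w i j : differentiable ('D_w f) x ->
    differentiable ('D_w (fun y => f y i j)) x.
  by move=> dw; apply: near_eq_differentiable (E w i j) _;
    apply: differentiable_entry.
have dmx w w' : differentiable ('D_w f) x ->
    'D_w' ('D_w f) x = \matrix_(i, j) 'D_w' (fun y => 'D_w f y i j) x.
  by move=> dw; rewrite derive_mx//; exact: diff_derivable.
rewrite (dmx u v du) (dmx v u dv).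
apply/matrixP => i j; rewrite [LHS]mxE [RHS]mxE.
rewrite (near_eq_derive _ (E u i j)) (near_eq_derive _ (E v i j)).
apply: derive_swap; try exact: dE.
by apply: filterS df => y; exact: differentiable_entry.
Qed.

Lemma smooth_derive_swap (R : realType) (V : normedModType R) (m n : nat)
    (U : set V) (f : V -> 'M[R]_(m, n)) (x u v : V) :
  open U -> smooth_on U f -> U x -> 'D_v ('D_u f) x = 'D_u ('D_v f) x.
Proof.
move=> oU sf Ux; have nU : nbhs x U by exact: open_nbhs_nbhs.
by apply: derive_swap_mx; apply: filterS nU => y Uy;
  apply: (smooth_differentiable (U := U)) => //; exact: smooth_derive.
Qed.

(** * The curvature tensor in coordinates *)

Lemma innerDl (R : realType) (n : nat) (A : 'M[R]_n) (u v w : 'rV[R]_n) :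
  inner A (u + v) w = inner A u w + inner A v w.
Proof. by rewrite /inner !mulmxDl mxE. Qed.

Lemma innerDr (R : realType) (n : nat) (A : 'M[R]_n) (u v w : 'rV[R]_n) :
  inner A u (v + w) = inner A u v + inner A u w.
Proof. by rewrite /inner linearD mulmxDr mxE. Qed.

Lemma innerDm (R : realType) (n : nat) (A B : 'M[R]_n) (u v : 'rV[R]_n) :
  inner (A + B) u v = inner A u v + inner B u v.
Proof. by rewrite /inner mulmxDr mulmxDl mxE. Qed.

Lemma innerZl (R : realType) (n : nat) (A : 'M[R]_n) (k : R) (u v : 'rV[R]_n) :
  inner A (k *: u) v = k * inner A u v.
Proof. by rewrite /inner -!scalemxAl mxE. Qed.

Lemma innerZr (R : realType) (n : nat) (A : 'M[R]_n) (k : R) (u v : 'rV[R]_n) :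
  inner A u (k *: v) = k * inner A u v.
Proof. by rewrite /inner linearZ /= -scalemxAr mxE. Qed.

Lemma innerNl (R : realType) (n : nat) (A : 'M[R]_n) (u v : 'rV[R]_n) :
  inner A (- u) v = - inner A u v.
Proof. by rewrite -scaleN1r innerZl mulN1r. Qed.

Lemma innerNr (R : realType) (n : nat) (A : 'M[R]_n) (u v : 'rV[R]_n) :
  inner A u (- v) = - inner A u v.
Proof. by rewrite -scaleN1r innerZr mulN1r. Qed.

Lemma inner0l (R : realType) (n : nat) (A : 'M[R]_n) (u : 'rV[R]_n) :
  inner A 0 u = 0.
Proof. by rewrite -(scale0r 0) innerZl mul0r. Qed.

Lemma inner0r (R : realType) (n : nat) (A : 'M[R]_n) (u : 'rV[R]_n) :
  inner A u 0 = 0.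
Proof. by rewrite -(scale0r 0) innerZr mul0r. Qed.

Lemma inner0m (R : realType) (n : nat) (u v : 'rV[R]_n) :
  inner (0 : 'M[R]_n) u v = 0.
Proof. by rewrite /inner mulmx0 mul0mx mxE. Qed.

Lemma differentiable_inner (R : realType) (V : normedModType R) (n : nat)
    (A : V -> 'M[R]_n) (X Y : V -> 'rV[R]_n) (x : V) :
  differentiable A x -> differentiable X x -> differentiable Y x ->
  differentiable (fun y => inner (A y) (X y) (Y y)) x.
Proof.
move=> dA dX dY; apply: differentiable_entry.
apply: differentiable_mulmx; first exact: differentiable_mulmx.
apply: differentiable_entries => i j; under eq_fun do rewrite mxE.
exact: differentiable_entry.
Qed.

(* First kind: [christoffel1 G x u v w] is g(Gamma(u, v), w) at [x]. *)
Definition christoffel1 (R : realType) (n : nat) (G : 'rV[R]_n -> 'M[R]_n)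
    (x u v w : 'rV[R]_n) : R :=
  2^-1 * (inner ('D_u G x) v w + inner ('D_v G x) u w - inner ('D_w G x) u v).

Lemma christoffelE (R : realType) (n : nat) (G : 'rV[R]_n -> 'M[R]_n)
    (x u v : 'rV[R]_n) :
  christoffel G x u v =
  (\row_k christoffel1 G x u v (delta_mx 0 k)) *m invmx (G x).
Proof. by congr (_ *m _); apply/rowP => k; rewrite !mxE. Qed.

Lemma derive_inner_cst (R : realType) (n : nat) (A : 'rV[R]_n -> 'M[R]_n)
    (x u v w : 'rV[R]_n) :
  differentiable A x ->
  'D_w (fun y => inner (A y) u v) x = inner ('D_w A x) u v.
Proof.
move=> dA; rewrite (derive_inner w dA (differentiable_cst u x)
  (differentiable_cst v x)).
by rewrite !derive_cst inner0l inner0r !addr0.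
Qed.

Definition derive_christoffel1 (R : realType) (n : nat)
    (G : 'rV[R]_n -> 'M[R]_n) (a x u v w : 'rV[R]_n) : R :=
  2^-1 * (inner ('D_x ('D_u G) a) v w + inner ('D_x ('D_v G) a) u w
          - inner ('D_x ('D_w G) a) u v).

Lemma derive_christoffel1E (R : realType) (n : nat) (G : 'rV[R]_n -> 'M[R]_n)
    (a x u v w : 'rV[R]_n) :
  (forall y, differentiable ('D_y G) a) ->
  'D_x (fun p => christoffel1 G p u v w) a = derive_christoffel1 G a x u v w.
Proof.
move=> dG.
have dI y b c : derivable (fun p => inner ('D_y G p) b c) a x.
  by apply: diff_derivable; apply: differentiable_inner => //;
    exact: differentiable_cst.
pose f y b c : 'rV[R]_n -> R := fun p => inner ('D_y G p) b c.
have -> : (fun p => christoffel1 G p u v w) =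
    2^-1 *: (f u v w + f v u w - f w u v).
  by [].
have df y b c : derivable (f y b c) a x by exact: dI.
have dfD := derivableD (df u v w) (df v u w).
rewrite (deriveZ _ (derivableB dfD (df w u v))) (deriveB dfD (df w u v)).
rewrite (deriveD (df u v w) (df v u w)).
have dE y b c : 'D_x (f y b c) a = inner ('D_x ('D_y G) a) b c.
  by rewrite /f derive_inner_cst.
by congr (_ * (_ + _ - _)); exact: dE.
Qed.

(** Constant fields commute, and metric compatibility replaces [<nabla_t nabla_u v, w>] by the
    [t]-derivative of [<nabla_u v, w>] minus [<nabla_u v, nabla_t w>]. Only first-kind symbols are
    differentiated, so the derivative terms are linear in the metric. *)
Lemma inner_curv_cst (R : realType) (n : nat) (G : 'rV[R]_n -> 'M[R]_n)
    (U : set 'rV[R]_n) (a x y z w : 'rV[R]_n) :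
  open U -> smooth_on U G -> (forall p, U p -> (G p)^T = G p) ->
  (forall p, U p -> G p \in unitmx) -> U a ->
  inner (G a) (curv G (cst x) (cst y) (cst z) a) w =
  derive_christoffel1 G a y x z w - derive_christoffel1 G a x y z w
  + inner (G a) (christoffel G a y z) (christoffel G a x w)
  - inner (G a) (christoffel G a x z) (christoffel G a y w).
Proof.
move=> oU sG symG uG Ua; have nU : nbhs a U by exact: open_nbhs_nbhs.
have dG p : U p -> differentiable G p by exact: smooth_differentiable.
have ddG u p : U p -> differentiable ('D_u G) p.
  exact/smooth_differentiable/smooth_derive.
have nabla_cst u v : nabla G (cst u) (cst v) = fun p => christoffel G p u v.
  by apply/funext => p; rewrite /nabla /= derive_cst add0r.
have dchr u v : differentiable (fun p => christoffel G p u v) a.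
  under eq_fun do rewrite christoffelE.
  apply: differentiable_mulmx; last first.
    by apply: smooth_differentiable Ua; exact: smooth_on_invmx.
  apply: differentiable_entries => i k; under eq_fun do rewrite mxE.
  by apply: differentiableZ; apply: differentiableB;
    first apply: differentiableD;
    (apply: differentiable_inner; first exact: ddG); exact: differentiable_cst.
have nchr u v t : inner (G a) (nabla G (cst t) (nabla G (cst u) (cst v)) a) w =
    derive_christoffel1 G a t u v w
    - inner (G a) (christoffel G a u v) (christoffel G a t w).
  have symGa : \forall p \near a, (G p)^T = G p.
    by apply: filterS nU => p; exact: symG.
  have := @nabla_metric _ _ G (fun p => christoffel G p u v) (cst w)
      (cst t) a symGa
    (uG a Ua) (dG a Ua) (dchr u v) (differentiable_cst w a).
  rewrite !nabla_cst [cst t a]/=.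
  rewrite (@near_eq_derive _ _ _ _ (fun p => christoffel1 G p u v w));
    last first.
    by apply: filterS nU => p Up; rewrite inner_christoffel//;
      [exact: uG|exact: dG].
  by rewrite derive_christoffel1E => [->|?]; [rewrite addrK|exact: ddG].
have nabla0 : nabla G (bracket (cst x) (cst y)) (cst z) a = 0.
  rewrite /nabla /bracket /= !derive_cst subrr add0r christoffelE.
  rewrite (_ : \row_k _ = 0) ?mul0mx//; apply/rowP => k; rewrite !mxE.
  by rewrite /christoffel1 derive0 inner0m !inner0l addr0 subrr mulr0.
rewrite /curv nabla0 sub0r innerDl innerNl.
rewrite [X in - X + _ = _](nchr y z x) [X in _ + X = _](nchr x z y).
move: (derive_christoffel1 G a x y z w) (derive_christoffel1 G a y x z w).
move: (inner _ _ _) (inner _ _ _) => A B C D.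
ring.
Qed.

Lemma smooth_on_eq (R : realType) (V W : normedModType R)
    (U : set V) (f g : V -> W) :
  open U -> (forall x, U x -> f x = g x) -> smooth_on U f -> smooth_on U g.
Proof.
move=> oU fg /smooth_onP sf; apply/smooth_onP => k.
exact: diff_upto_eq fg (sf k).
Qed.

Lemma smooth_on_jacobian (R : realType) (m n : nat) (U : set 'rV[R]_m)
    (F : 'rV[R]_m -> 'rV[R]_n) :
  open U -> smooth_on U F -> smooth_on U (jacobian F).
Proof.
move=> oU sF; apply/smooth_on_entries => // i j.
apply: (@smooth_on_eq _ _ _ _ (fun x => 'D_(delta_mx 0 i) F x 0 j)) => //
  [x Ux|].
  by rewrite deriveE ?mxE//; exact: smooth_differentiable sF Ux.
by have /smooth_derive/(smooth_on_entries _ oU) := sF; apply.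
Qed.

(** * Submersions between coordinate domains *)

(* The last field says that the differential of [F] maps the orthogonal
   complement of its kernel isometrically onto R^n: in matrices, with ['J F] the
   Jacobian acting on rows, the metric induced on covectors by [Gb] is that of
   [G]. *)
Record local_submersion (R : realType) (m n : nat)
    (U : set 'rV[R]_m) (W : set 'rV[R]_n)
    (Gb : 'rV[R]_m -> 'M[R]_m) (G : 'rV[R]_n -> 'M[R]_n)
    (F : 'rV[R]_m -> 'rV[R]_n) : Prop := LocalSubmersion {
  ls_open_src : open U;
  ls_open_tgt : open W;
  ls_maps : forall p, U p -> W (F p);
  ls_smooth_map : smooth_on U F;
  ls_smooth_src : smooth_on U Gb;
  ls_smooth_tgt : smooth_on W G;
  ls_sym_src : forall p, U p -> (Gb p)^T = Gb p;
  ls_sym_tgt : forall q, W q -> (G q)^T = G q;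
  ls_unit_src : forall p, U p -> Gb p \in unitmx;
  ls_unit_tgt : forall q, W q -> G q \in unitmx;
  ls_cometric : forall p, U p ->
    ('J F p)^T *m invmx (Gb p) *m 'J F p *m G (F p) = 1%:M }.

Lemma derive_mulmx (R : realType) (V : normedModType R) (l m n : nat)
    (A : V -> 'M[R]_(l, m)) (B : V -> 'M[R]_(m, n)) (p v : V) :
  differentiable A p -> differentiable B p ->
  'D_v (fun q => A q *m B q) p = 'D_v A p *m B p + A p *m 'D_v B p.
Proof.
move=> dA dB; have dAB := differentiable_mulmx dA dB.
have DE k k' (C : V -> 'M[R]_(k, k')) : differentiable C p ->
    'D_v C p = \matrix_(i, j) 'D_v (fun q => C q i j) p.
  by move=> dC; rewrite derive_mx//; exact: diff_derivable.
rewrite (DE _ _ _ dA) (DE _ _ _ dB) (DE _ _ _ dAB).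
apply/matrixP => i j.
rewrite [LHS]mxE [RHS]mxE [X in X + _]mxE [X in _ + X]mxE -big_split /=.
have dAe k : derivable (fun q => A q i k) p v.
  by apply: diff_derivable; exact: differentiable_entry.
have dBe k : derivable (fun q => B q k j) p v.
  by apply: diff_derivable; exact: differentiable_entry.
have -> : (fun q => (A q *m B q) i j) =
    \sum_k ((fun q => A q i k) * (fun q => B q k j)).
  by apply/funext => q; rewrite fct_sumE mxE.
rewrite derive_sum => [|k]; last exact: derivableM.
apply: eq_bigr => k _; rewrite (deriveM (dAe k) (dBe k)) addrC.
by congr (_ + _); [rewrite [X in _ = _ * X]mxE
                  |rewrite [X in _ = X * _]mxE; exact: mulrC].
Qed.

Lemma differentiable_scale (R : realType) (V : normedModType R) (m n : nat)
    (k : V -> R) (A : V -> 'M[R]_(m, n)) (p : V) :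
  differentiable k p -> differentiable A p ->
  differentiable (fun q => k q *: A q) p.
Proof.
move=> dk dA; apply: differentiable_entries => i j.
under eq_fun do rewrite mxE.
by apply: differentiableM => //; exact: differentiable_entry.
Qed.

Lemma derive_scale (R : realType) (V : normedModType R) (m n : nat)
    (k : V -> R) (A : V -> 'M[R]_(m, n)) (p v : V) :
  differentiable k p -> differentiable A p ->
  'D_v (fun q => k q *: A q) p = 'D_v k p *: A p + k p *: 'D_v A p.
Proof.
move=> dk dA; have dkA := differentiable_scale dk dA.
rewrite (derive_mx (diff_derivable dkA)) (derive_mx (diff_derivable dA)).
apply/matrixP => i j; have dkv : derivable k p v by exact: diff_derivable.
have dAv : derivable (fun q => A q i j) p v.
  by apply: diff_derivable; exact: differentiable_entry.
rewrite [LHS]mxE.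
have -> : (fun q => (k q *: A q) i j) = k * (fun q => A q i j).
  by apply/funext => q; rewrite mxE.
rewrite (deriveM dkv dAv) [RHS]mxE [X in _ = X + _]mxE [X in _ = _ + X]mxE.
by rewrite [X in _ = _ + _ * X]mxE addrC; congr (_ + _); exact: mulrC.
Qed.

Lemma derive_trmx (R : realType) (V : normedModType R) (m n : nat)
    (A : V -> 'M[R]_(m, n)) (p v : V) :
  differentiable A p -> 'D_v (fun q => (A q)^T) p = ('D_v A p)^T.
Proof.
move=> dA; have dAT : differentiable (fun q => (A q)^T) p.
  apply: differentiable_entries => i j; under eq_fun do rewrite mxE.
  exact: differentiable_entry.
rewrite !derive_mx; try exact: diff_derivable.
apply/matrixP => i j; rewrite [LHS]mxE [RHS]mxE [RHS]mxE.
by under eq_fun do rewrite mxE.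
Qed.

Lemma derive_inner_along (R : realType) (V : normedModType R) (n : nat)
    (A : V -> 'M[R]_n) (X Y : V -> 'rV[R]_n) (p v : V) :
  differentiable A p -> differentiable X p -> differentiable Y p ->
  'D_v (fun q => inner (A q) (X q) (Y q)) p =
  inner ('D_v A p) (X p) (Y p) + inner (A p) ('D_v X p) (Y p)
  + inner (A p) (X p) ('D_v Y p).
Proof.
move=> dA dX dY; have dXA := differentiable_mulmx dX dA.
have dYT : differentiable (fun q => (Y q)^T) p.
  apply: differentiable_entries => i j; under eq_fun do rewrite mxE.
  exact: differentiable_entry.
have dXAY := differentiable_mulmx dXA dYT.
have -> : 'D_v (fun q => inner (A q) (X q) (Y q)) p =
    'D_v (fun q => X q *m A q *m (Y q)^T) p 0 0.
  by rewrite (derive_mx (diff_derivable dXAY)) mxE.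
rewrite (derive_mulmx v dXA dYT) (derive_mulmx v dX dA) (derive_trmx v dY).
rewrite /inner; move: ('D_v A p) ('D_v X p) ('D_v Y p) => A' X' Y'.
by rewrite !mulmxDl !mxE; congr (_ + _); rewrite addrC.
Qed.

Lemma derive_mulmxl (R : realType) (V : normedModType R) (l m n : nat)
    (A : V -> 'M[R]_(m, n)) (c : 'M[R]_(l, m)) (p b : V) :
  differentiable A p -> 'D_b (fun q => c *m A q) p = c *m 'D_b A p.
Proof.
move=> dA; rewrite (derive_mulmx b (differentiable_cst c p) dA) derive_cst.
by rewrite mul0mx add0r.
Qed.

Lemma derive_inner0l (R : realType) (n : nat) (A : 'rV[R]_n -> 'M[R]_n)
    (X Y : 'rV[R]_n -> 'rV[R]_n) (x v : 'rV[R]_n) :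
  differentiable A x -> differentiable X x -> differentiable Y x -> X x = 0 ->
  'D_v (fun y => inner (A y) (X y) (Y y)) x = inner (A x) ('D_v X x) (Y x).
Proof.
move=> dA dX dY X0; rewrite (derive_inner v dA dX dY) X0.
move: ('D_v A x) ('D_v X x) ('D_v Y x) => A' X' Y'.
by rewrite !inner0l add0r addr0.
Qed.

Lemma derive_inner0r (R : realType) (n : nat) (A : 'rV[R]_n -> 'M[R]_n)
    (X Y : 'rV[R]_n -> 'rV[R]_n) (x v : 'rV[R]_n) :
  differentiable A x -> differentiable X x -> differentiable Y x -> Y x = 0 ->
  'D_v (fun y => inner (A y) (X y) (Y y)) x = inner (A x) (X x) ('D_v Y x).
Proof.
move=> dA dX dY Y0; rewrite (derive_inner v dA dX dY) Y0.
move: ('D_v A x) ('D_v X x) ('D_v Y x) => A' X' Y'.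
by rewrite !inner0r !add0r.
Qed.

(** * Splitting of the metric upstairs into pullback and vertical part *)

Section LocalSubmersion.
Context (R : realType) (m n : nat) (U : set 'rV[R]_m) (W : set 'rV[R]_n)
  (Gb : 'rV[R]_m -> 'M[R]_m) (G : 'rV[R]_n -> 'M[R]_n)
  (F : 'rV[R]_m -> 'rV[R]_n) (ls : local_submersion U W Gb G F).

Let oU := ls_open_src ls.
Let oW := ls_open_tgt ls.
Let sF := ls_smooth_map ls.
Let sGb := ls_smooth_src ls.
Let sG := ls_smooth_tgt ls.

Definition pullback (p : 'rV[R]_m) : 'M[R]_m :=
  'J F p *m G (F p) *m ('J F p)^T.

(* The metric restricted to the vertical directions, extended by 0 to the
   horizontal ones. *)
Definition vertical (p : 'rV[R]_m) : 'M[R]_m := Gb p - pullback p.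

Let L (p : 'rV[R]_m) : 'M[R]_m := invmx (Gb p).

Lemma smooth_pullback : smooth_on U pullback.
Proof.
have sJ := smooth_on_jacobian oU sF.
apply: smooth_on_mulmx => //; last exact: smooth_on_trmx.
apply: smooth_on_mulmx => //.
exact: smooth_on_comp (ls_maps ls) sF sG.
Qed.

Lemma smooth_vertical : smooth_on U vertical.
Proof.
apply: smooth_onD => //; apply: smooth_onNmx => //; exact: smooth_pullback.
Qed.

Lemma smooth_inverse : smooth_on U L.
Proof. apply: smooth_on_invmx => //; exact: (ls_unit_src ls). Qed.

Lemma derive_jacobian p v : U p -> 'D_v F p = v *m 'J F p.
Proof. by move=> Up; rewrite deriveEjacobian//;
  exact: (smooth_differentiable sF Up). Qed.

Lemma inner_pullback p u v : U p ->
  inner (pullback p) u v = inner (G (F p)) ('D_u F p) ('D_v F p).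
Proof.
by move=> Up; rewrite !derive_jacobian// /inner /pullback trmx_mul !mulmxA.
Qed.

Lemma pullback_sym p : U p -> (pullback p)^T = pullback p.
Proof.
move=> Up; rewrite /pullback !trmx_mul trmxK mulmxA.
by rewrite (ls_sym_tgt ls (ls_maps ls Up)).
Qed.

Lemma vertical_sym p : U p -> (vertical p)^T = vertical p.
Proof.
by move=> Up; rewrite /vertical linearB /= (ls_sym_src ls)// pullback_sym.
Qed.

Lemma inverse_sym p : U p -> (L p)^T = L p.
Proof. by move=> Up; rewrite /L trmx_inv (ls_sym_src ls). Qed.

(** [ls_cometric] gives [h L h = h] for the pullback [h]. As [h + k] is inverse to [L], this makes
    [h L] and [k L] complementary projections. *)
Lemma vertical_idem p : U p -> vertical p *m L p *m vertical p = vertical p.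
Proof.
move=> Up; have uG := ls_unit_src ls Up.
have hLh : pullback p *m L p *m pullback p = pullback p.
  have := ls_cometric ls Up; rewrite -/(L p) /pullback => co.
  transitivity ('J F p *m G (F p) *m
      (('J F p)^T *m L p *m 'J F p *m G (F p)) *m ('J F p)^T).
    by rewrite !mulmxA.
  by rewrite co mulmx1.
rewrite /vertical mulmxBl mulmxV// mulmxBl mul1mx mulmxBr hLh mulmxKV//.
by rewrite subrr subr0.
Qed.

(** A vector of the base is lowered by [G], pulled back as a covector and raised by [L]; this gives
    its preimage orthogonal to the kernel of the differential of [F]. *)
Definition horizontal_lift (p : 'rV[R]_m) : 'M[R]_(n, m) :=
  G (F p) *m ('J F p)^T *m L p.

Lemma cometric_inv p : U p -> G (F p) *m (('J F p)^T *m L p *m 'J F p) = 1%:M.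
Proof. by move=> Up; apply: mulmx1C; exact: (ls_cometric ls Up). Qed.

Lemma lift_jacobian p : U p -> horizontal_lift p *m 'J F p = 1%:M.
Proof. by move=> Up; rewrite -(cometric_inv Up) /horizontal_lift !mulmxA. Qed.

Lemma lift_vertical p : U p -> horizontal_lift p *m vertical p = 0.
Proof.
move=> Up; rewrite /vertical mulmxBr /pullback !mulmxA lift_jacobian//.
by rewrite mul1mx /horizontal_lift mulmxKV ?subrr//; exact: (ls_unit_src ls Up).
Qed.

Lemma derive_mulmx_vertical p b (c : 'rV[R]_m) : U p ->
  'D_b (fun q => c *m vertical q) p = c *m 'D_b vertical p.
Proof.
move=> Up.
exact: (derive_mulmxl c b (smooth_differentiable smooth_vertical Up)).
Qed.

(** The product rule for [vertical_idem], grouped so that every undifferentiated [vertical] stands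
    next to [c] or [d], where a horizontal vector annihilates it. *)
Lemma inner_derive_vertical p b (c d : 'rV[R]_m) : U p ->
  inner ('D_b vertical p) c d =
  inner ('D_b L p) (c *m vertical p) (d *m vertical p)
  + inner (L p) (c *m 'D_b vertical p) (d *m vertical p)
  + inner (L p) (c *m vertical p) (d *m 'D_b vertical p).
Proof.
move=> Up; have nU : nbhs p U by exact: open_nbhs_nbhs.
have dV : differentiable vertical p by
    exact: smooth_differentiable smooth_vertical Up.
have dL : differentiable L p by exact: smooth_differentiable smooth_inverse Up.
rewrite -derive_inner_cst//.
rewrite (@near_eq_derive _ _ _ _
    (fun q => inner (L q) (c *m vertical q) (d *m vertical q))).
  rewrite derive_inner ?derive_mulmx_vertical//;
  by apply: differentiable_mulmx => //; exact: differentiable_cst.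
apply: filterS nU => q Uq.
by rewrite /inner trmx_mul vertical_sym// -{1}(vertical_idem Uq) !mulmxA.
Qed.

(** Only one term of the product rule survives. The covector [c *m 'D_b vertical p] is thus fixed by
    a projection whose image annihilates horizontal vectors. *)
Lemma derive_vertical_horizontal p b (c : 'rV[R]_m) : U p ->
  c *m vertical p = 0 ->
  c *m 'D_b vertical p = c *m 'D_b vertical p *m L p *m vertical p.
Proof.
move=> Up cK; apply/rowP => k.
have := inner_derive_vertical b c (delta_mx 0 k) Up.
rewrite cK !inner0l add0r addr0 /inner trmx_mul vertical_sym//.
by rewrite !mulmxA trmx_delta -!colE !mxE.
Qed.

(** Of the three terms of [inner_derive_vertical], the first contains two factors that vanish at
    [p], so its derivative is zero; each of the others contains one, which the second derivative
    must hit. *)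
Lemma inner_derive2_vertical p x y (c d : 'rV[R]_m) : U p ->
  c *m vertical p = 0 -> d *m vertical p = 0 ->
  inner ('D_x ('D_y vertical) p) c d =
  inner (L p) (c *m 'D_y vertical p) (d *m 'D_x vertical p)
  + inner (L p) (c *m 'D_x vertical p) (d *m 'D_y vertical p).
Proof.
move=> Up cK dK; have nU : nbhs p U by exact: open_nbhs_nbhs.
have sV := smooth_vertical; have sL := smooth_inverse.
have dV : differentiable vertical p by exact: smooth_differentiable Up.
have dL : differentiable L p by exact: smooth_differentiable Up.
have ddV : differentiable ('D_y vertical) p.
  exact: smooth_differentiable (smooth_derive y sV) Up.
have ddL : differentiable ('D_y L) p.
  exact: smooth_differentiable (smooth_derive y sL) Up.
have dcV (e : 'rV[R]_m) : differentiable (fun q => e *m vertical q) p.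
  by apply: differentiable_mulmx => //; exact: differentiable_cst.
have dcDV (e : 'rV[R]_m) : differentiable (fun q => e *m 'D_y vertical q) p.
  by apply: differentiable_mulmx => //; exact: differentiable_cst.
rewrite -derive_inner_cst//.
pose f1 q := inner ('D_y L q) (c *m vertical q) (d *m vertical q).
pose f2 q := inner (L q) (c *m 'D_y vertical q) (d *m vertical q).
pose f3 q := inner (L q) (c *m vertical q) (d *m 'D_y vertical q).
have df1 : derivable f1 p x by apply: diff_derivable;
    exact: differentiable_inner.
have df2 : derivable f2 p x by apply: diff_derivable;
    exact: differentiable_inner.
have df3 : derivable f3 p x by apply: diff_derivable;
    exact: differentiable_inner.
transitivity ('D_x (f1 + f2 + f3) p).
  by apply: near_eq_derive; apply: filterS nU => q Uq;
    exact: inner_derive_vertical.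
rewrite (deriveD (derivableD df1 df2) df3) (deriveD df1 df2).
have -> : 'D_x f1 p = 0.
  by rewrite (derive_inner0l x ddL (dcV c) (dcV d) cK) dK inner0r.
have -> : 'D_x f2 p = inner (L p) (c *m 'D_y vertical p) (d *m 'D_x vertical p).
  by rewrite (derive_inner0r x dL (dcDV c) (dcV d) dK) derive_mulmx_vertical.
have -> : 'D_x f3 p = inner (L p) (c *m 'D_x vertical p) (d *m 'D_y vertical p).
  by rewrite (derive_inner0l x dL (dcV c) (dcDV d) cK) derive_mulmx_vertical.
by rewrite add0r.
Qed.

Lemma derive_tgt (g : 'rV[R]_n -> 'M[R]_n) p v : smooth_on W g -> U p ->
  'D_v (fun q => g (F q)) p = 'D_('D_v F p) g (F p).
Proof.
move=> sg Up; have dF := smooth_differentiable sF Up.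
have dg := smooth_differentiable sg (ls_maps ls Up).
rewrite deriveE; last exact: (differentiable_comp dF dg).
by rewrite (diff_comp dF dg) /= !deriveE.
Qed.

Lemma derive2_tgt p x y : U p ->
  'D_x ('D_y (fun q => G (F q))) p =
  'D_('D_x ('D_y F) p) G (F p) + 'D_('D_x F p) ('D_('D_y F p) G) (F p).
Proof.
move=> Up; have nU : nbhs p U by exact: open_nbhs_nbhs.
have UW := ls_maps ls; have WFp := UW p Up.
have nW : nbhs (F p) W by exact: open_nbhs_nbhs.
(* The direction ['D_y F q] moves with [q]. Expanding in the partial derivatives of [G] separates it
   from the base point, so that the product rule applies. *)
pose dG i := 'D_(delta_mx 0 i) G.
have DG q v : W q -> 'D_v G q = \sum_i v 0 i *: dG i q.
  move=> Wq; have dGq := smooth_differentiable sG Wq.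
  rewrite (deriveE _ dGq) [in LHS](row_sum_delta v) linear_sum /=.
  by apply: eq_bigr => i _; rewrite linearZ /= -deriveE.
have ddF : differentiable ('D_y F) p.
  exact: smooth_differentiable (smooth_derive y sF) Up.
have sdG i : smooth_on W (dG i) by exact: smooth_derive.
have dphi i : differentiable (fun q => 'D_y F q 0 i) p.
  exact: differentiable_entry.
have dg i : differentiable (fun q => dG i (F q)) p.
  apply: (differentiable_comp (g := dG i) (smooth_differentiable sF Up)).
  exact: smooth_differentiable (sdG i) WFp.
have -> : 'D_x ('D_y (fun q => G (F q))) p =
    'D_x (\sum_i (fun q => 'D_y F q 0 i *: dG i (F q))) p.
  apply: near_eq_derive; apply: filterS nU => q Uq.
  by rewrite derive_tgt// (DG _ _ (UW q Uq)) fct_sumE.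
have -> : 'D_('D_x F p) ('D_('D_y F p) G) (F p) =
    'D_('D_x F p) (\sum_i ('D_y F p 0 i *: dG i)) (F p).
  apply: near_eq_derive; apply: filterS nW => q Wq.
  by rewrite (DG _ _ Wq) fct_sumE.
rewrite (DG _ _ WFp).
rewrite derive_sum => [|i]; last first.
  apply: diff_derivable; exact: differentiable_scale.
rewrite derive_sum => [|i]; last first.
  apply: derivableZ; apply: diff_derivable.
  exact: smooth_differentiable (sdG i) WFp.
rewrite -big_split /=; apply: eq_bigr => i _.
rewrite (derive_scale x (dphi i) (dg i)) (derive_tgt x (sdG i) Up).
rewrite deriveZ; last first.
  by apply: diff_derivable; exact: smooth_differentiable (sdG i) WFp.
by rewrite (derive_mx (diff_derivable ddF)) mxE.
Qed.

End LocalSubmersion.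

(** * Curvature of the base through the pullback of its metric *)

Lemma derive2_gram_sym (R : realType) (n : nat) (G : 'rV[R]_n -> 'M[R]_n)
    (U : set 'rV[R]_n) (p u v : 'rV[R]_n) :
  open U -> smooth_on U G -> (forall q, U q -> (G q)^T = G q) -> U p ->
  ('D_u ('D_v G) p)^T = 'D_u ('D_v G) p.
Proof.
move=> oU sG symG Up.
have nU q : U q -> nbhs q U by move=> Uq; exact: open_nbhs_nbhs.
apply: derive_gram_sym; last first.
  exact: smooth_differentiable (smooth_derive v sG) Up.
apply: filterS (nU p Up) => q Uq.
apply: derive_gram_sym; last exact: smooth_differentiable sG Uq.
exact: filterS symG (nU q Uq).
Qed.

(* In the notation of [pullback_curvature] below: [gi] is the i-th derivative of
   the metric [G], [fi] the i-th derivative of [F], and [h2] the second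
   derivative of the pullback of [G] by [F]. *)
Lemma pullback_curvature_algebra (R : realType) (I V : Type)
    (g0 : V -> V -> R) (g1 : V -> V -> V -> R) (g2 : V -> V -> V -> V -> R)
    (f1 : I -> V) (f2 : I -> I -> V) (f3 : I -> I -> I -> V)
    (h2 : I -> I -> I -> I -> R) (x y z w : I) :
  (forall p q, g0 p q = g0 q p) ->
  (forall a p q, g1 a p q = g1 a q p) ->
  (forall a b p q, g2 a b p q = g2 a b q p) ->
  (forall i j, f2 i j = f2 j i) ->
  (forall i j k, f3 i j k = f3 j i k) ->
  (forall i j k, f3 i j k = f3 i k j) ->
  (forall i j k l, h2 i j k l =
    g1 (f2 i j) (f1 k) (f1 l) + g2 (f1 i) (f1 j) (f1 k) (f1 l)
    + g1 (f1 j) (f2 i k) (f1 l) + g1 (f1 j) (f1 k) (f2 i l)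
    + g1 (f1 i) (f2 j k) (f1 l) + g0 (f3 i j k) (f1 l)
    + g0 (f2 j k) (f2 i l) + g1 (f1 i) (f1 k) (f2 j l)
    + g0 (f2 i k) (f2 j l) + g0 (f1 k) (f3 i j l)) ->
  let c1 u v t := 2^-1 * (g1 u v t + g1 v u t - g1 t u v) in
  let c2 a u v t := 2^-1 * (g2 a u v t + g2 a v u t - g2 a t u v) in
  2^-1 * (h2 y x z w + h2 y z x w - h2 y w x z)
  - 2^-1 * (h2 x y z w + h2 x z y w - h2 x w y z)
  + (c1 (f1 y) (f1 z) (f2 x w) + c1 (f1 x) (f1 w) (f2 y z)
     + g0 (f2 y z) (f2 x w))
  - (c1 (f1 x) (f1 z) (f2 y w) + c1 (f1 y) (f1 w) (f2 x z)
     + g0 (f2 x z) (f2 y w)) =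
  c2 (f1 y) (f1 x) (f1 z) (f1 w) - c2 (f1 x) (f1 y) (f1 z) (f1 w).
Proof.
move=> g0C g1C g2C f2C f3C12 f3C23 h2E c1 c2; rewrite /c1 /c2 !h2E.
rewrite (f2C y x) (f2C z x) (f2C w x) (f2C z y) (f2C w y) (f2C w z).
rewrite (f3C23 y z x) (f3C23 y w x) (f3C23 x z y) (f3C23 x w y) (f3C23 x w z).
rewrite (f3C23 y w z) (f3C12 y x z) (f3C12 y x w).
(* [field] cannot use symmetry hypotheses; writing each form as a symmetrization [s p q + s q p]
   builds the symmetry into the terms. *)
have [s0 s0E] : exists s, forall p q, g0 p q = s p q + s q p.
  by exists (fun p q => 2^-1 * g0 p q) => p q; rewrite (g0C q p); field.
have [s1 s1E] : exists s, forall a p q, g1 a p q = s a p q + s a q p.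
  by exists (fun a p q => 2^-1 * g1 a p q) => a p q; rewrite (g1C a q p); field.
have [s2 s2E] : exists s, forall a b p q, g2 a b p q = s a b p q + s a b q p.
  exists (fun a b p q => 2^-1 * g2 a b p q) => a b p q.
  by rewrite (g2C a b q p); field.
by rewrite !s0E !s1E !s2E; field.
Qed.

Section PullbackCurvature.

Context (R : realType) (m n : nat) (U : set 'rV[R]_m) (W : set 'rV[R]_n)
  (Gb : 'rV[R]_m -> 'M[R]_m) (G : 'rV[R]_n -> 'M[R]_n)
  (F : 'rV[R]_m -> 'rV[R]_n) (ls : local_submersion U W Gb G F).

Let oU := ls_open_src ls.
Let oW := ls_open_tgt ls.
Let sF := ls_smooth_map ls.
Let sG := ls_smooth_tgt ls.
Let h := pullback G F.

Lemma derive3_swap12 p u v w : U p ->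
  'D_u ('D_v ('D_w F)) p = 'D_v ('D_u ('D_w F)) p.
Proof. by move=> Up; apply: smooth_derive_swap Up => //;
  exact: smooth_derive. Qed.

Lemma derive3_swap23 p u v w : U p ->
  'D_u ('D_v ('D_w F)) p = 'D_u ('D_w ('D_v F)) p.
Proof.
move=> Up; apply: near_eq_derive.
apply: filterS (open_nbhs_nbhs (conj oU Up)) => q Uq.
exact: smooth_derive_swap sF Uq.
Qed.

Lemma inner_derive_pullback p y z w : U p ->
  inner ('D_y h p) z w =
  inner ('D_('D_y F p) G (F p)) ('D_z F p) ('D_w F p)
  + inner (G (F p)) ('D_y ('D_z F) p) ('D_w F p)
  + inner (G (F p)) ('D_z F p) ('D_y ('D_w F) p).
Proof.
move=> Up; have nU : nbhs p U by exact: open_nbhs_nbhs.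
rewrite -derive_inner_cst; last first.
  exact: smooth_differentiable (smooth_pullback ls) Up.
transitivity ('D_y (fun q => inner (G (F q)) ('D_z F q) ('D_w F q)) p).
  apply: near_eq_derive; apply: filterS nU => q Uq; exact: (inner_pullback ls).
have sGF := smooth_on_comp oU oW (ls_maps ls) sF sG.
have dd v : differentiable ('D_v F) p.
  exact: smooth_differentiable (smooth_derive v sF) Up.
rewrite (derive_inner_along y (smooth_differentiable sGF Up) (dd z) (dd w)).
by rewrite (derive_tgt ls y sG Up).
Qed.

Lemma inner_derive2_pullback p x y z w : U p ->
  inner ('D_x ('D_y h) p) z w =
  inner ('D_('D_x ('D_y F) p) G (F p)) ('D_z F p) ('D_w F p)
  + inner ('D_('D_x F p) ('D_('D_y F p) G) (F p)) ('D_z F p) ('D_w F p)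
  + inner ('D_('D_y F p) G (F p)) ('D_x ('D_z F) p) ('D_w F p)
  + inner ('D_('D_y F p) G (F p)) ('D_z F p) ('D_x ('D_w F) p)
  + inner ('D_('D_x F p) G (F p)) ('D_y ('D_z F) p) ('D_w F p)
  + inner (G (F p)) ('D_x ('D_y ('D_z F)) p) ('D_w F p)
  + inner (G (F p)) ('D_y ('D_z F) p) ('D_x ('D_w F) p)
  + inner ('D_('D_x F p) G (F p)) ('D_z F p) ('D_y ('D_w F) p)
  + inner (G (F p)) ('D_x ('D_z F) p) ('D_y ('D_w F) p)
  + inner (G (F p)) ('D_z F p) ('D_x ('D_y ('D_w F)) p).
Proof.
move=> Up; have nU : nbhs p U by exact: open_nbhs_nbhs.
have sGF := smooth_on_comp oU oW (ls_maps ls) sF sG.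
rewrite -derive_inner_cst; last first.
  exact: smooth_differentiable (smooth_derive y (smooth_pullback ls)) Up.
pose GF q := G (F q).
pose f1 q := inner ('D_y GF q) ('D_z F q) ('D_w F q).
pose f2 q := inner (GF q) ('D_y ('D_z F) q) ('D_w F q).
pose f3 q := inner (GF q) ('D_z F q) ('D_y ('D_w F) q).
have dF v : differentiable ('D_v F) p.
  exact: smooth_differentiable (smooth_derive v sF) Up.
have ddF v v' : differentiable ('D_v ('D_v' F)) p.
  exact: smooth_differentiable (smooth_derive v (smooth_derive v' sF)) Up.
have dGF : differentiable GF p by exact: smooth_differentiable sGF Up.
have ddGF : differentiable ('D_y GF) p.
  exact: smooth_differentiable (smooth_derive y sGF) Up.
have df1 : derivable f1 p x by apply: diff_derivable;
    exact: differentiable_inner.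
have df2 : derivable f2 p x by apply: diff_derivable;
    exact: differentiable_inner.
have df3 : derivable f3 p x by apply: diff_derivable;
    exact: differentiable_inner.
transitivity ('D_x (f1 + f2 + f3) p).
  apply: near_eq_derive; apply: filterS nU => q Uq.
  transitivity (f1 q + f2 q + f3 q) => //.
  by rewrite (inner_derive_pullback y z w Uq) /f1 /GF (derive_tgt ls y sG Uq).
rewrite (deriveD (derivableD df1 df2) df3) (deriveD df1 df2).
have E1 : 'D_x f1 p = inner ('D_x ('D_y GF) p) ('D_z F p) ('D_w F p)
    + inner ('D_y GF p) ('D_x ('D_z F) p) ('D_w F p)
    + inner ('D_y GF p) ('D_z F p) ('D_x ('D_w F) p).
  exact: derive_inner_along.
have E2 : 'D_x f2 p = inner ('D_x GF p) ('D_y ('D_z F) p) ('D_w F p)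
    + inner (GF p) ('D_x ('D_y ('D_z F)) p) ('D_w F p)
    + inner (GF p) ('D_y ('D_z F) p) ('D_x ('D_w F) p).
  exact: derive_inner_along.
have E3 : 'D_x f3 p = inner ('D_x GF p) ('D_z F p) ('D_y ('D_w F) p)
    + inner (GF p) ('D_x ('D_z F) p) ('D_y ('D_w F) p)
    + inner (GF p) ('D_z F p) ('D_x ('D_y ('D_w F)) p).
  exact: derive_inner_along.
apply: (etrans (congr2 +%R (congr2 +%R E1 E2) E3)).
rewrite (derive2_tgt ls x y Up) (derive_tgt ls y sG Up) (derive_tgt ls x sG Up).
rewrite (innerDm ('D_('D_x ('D_y F) p) G (F p))
  ('D_('D_x F p) ('D_('D_y F p) G) (F p)) ('D_z F p) ('D_w F p)).
have assoc (a b c d e f g a' b' c' : R) : a + b + c + d + (e + f + g)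
    + (a' + b' + c') = a + b + c + d + e + f + g + a' + b' + c'.
  by rewrite !addrA.
exact: assoc.
Qed.

(* The Hessian of [F] with respect to the connection of [G] downstairs and the
   flat connection upstairs. *)
Definition hessian (p u v : 'rV[R]_m) : 'rV[R]_n :=
  christoffel G (F p) ('D_u F p) ('D_v F p) + 'D_u ('D_v F) p.

Lemma inner_tgtC p u v : U p -> inner (G (F p)) u v = inner (G (F p)) v u.
Proof. by move=> Up; apply: inner_sym;
  apply: (ls_sym_tgt ls (ls_maps ls Up)). Qed.

Lemma inner_christoffel_tgt p u v w : U p ->
  inner (G (F p)) (christoffel G (F p) u v) w = christoffel1 G (F p) u v w.
Proof.
move=> Up; have WF := ls_maps ls Up; rewrite inner_christoffel//.
  exact: (ls_unit_tgt ls WF).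
exact: smooth_differentiable sG WF.
Qed.

Lemma near_tgt_sym p : U p -> \forall q \near F p, (G q)^T = G q.
Proof.
move=> Up; apply: filterS (open_nbhs_nbhs (conj oW (ls_maps ls Up))).
exact: (ls_sym_tgt ls).
Qed.

Lemma inner_derive_tgtC p u v w : U p ->
  inner ('D_u G (F p)) v w = inner ('D_u G (F p)) w v.
Proof.
move=> Up; apply: inner_sym; apply: derive_gram_sym; first exact: near_tgt_sym.
exact: smooth_differentiable sG (ls_maps ls Up).
Qed.

(** The Hessian takes the place of the image under the differential of [F] of a Levi-Civita
    derivative for [h]. In the Koszul combination the second derivatives of [F] involving [w]
    cancel, and the one along [u] and [v] remains. *)
Lemma christoffel1_pullback p u v w : U p ->
  christoffel1 h p u v w = inner (G (F p)) (hessian p u v) ('D_w F p).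
Proof.
move=> Up.
have alg (I V : Type) (g0 : V -> V -> R) (g1 : V -> V -> V -> R) (f1 : I -> V)
    (f2 : I -> I -> V) (a b c : I) : (forall i j, g0 i j = g0 j i) ->
    (forall i j, f2 i j = f2 j i) ->
    let h1 i j k :=
      g1 (f1 i) (f1 j) (f1 k) + g0 (f2 i j) (f1 k) + g0 (f1 j) (f2 i k) in
    2^-1 * (h1 a b c + h1 b a c - h1 c a b) =
    2^-1 * (g1 (f1 a) (f1 b) (f1 c) + g1 (f1 b) (f1 a) (f1 c)
            - g1 (f1 c) (f1 a) (f1 b)) + g0 (f2 a b) (f1 c).
  move=> g0C f2C /=.
  rewrite (f2C b a) (f2C c a) (f2C c b) (g0C (f1 b)) (g0C (f1 a)).
  by field.
transitivity (christoffel1 G (F p) ('D_u F p) ('D_v F p) ('D_w F p)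
    + inner (G (F p)) ('D_u ('D_v F) p) ('D_w F p)).
  apply: etrans (alg 'rV[R]_m 'rV[R]_n (inner (G (F p)))
    (fun a => inner ('D_a G (F p))) (fun i => 'D_i F p)
    (fun i j => 'D_i ('D_j F) p) u v w (fun i j => inner_tgtC i j Up)
    (fun i j => smooth_derive_swap j i oU sF Up)).
  by congr (_ * (_ + _ - _)); exact: inner_derive_pullback.
rewrite /hessian -(inner_christoffel_tgt _ _ _ Up).
exact: (esym (innerDl _ _ _ _)).
Qed.

(** Naturality of curvature for a possibly degenerate pullback: the left side is the expression of
    [inner_curv_cst] for [h], with Hessians measured by [G] instead of Christoffel vectors measured
    by [h]. The third derivatives of [F] cancel by symmetry. *)
Lemma pullback_curvature p x y z w : U p ->
  derive_christoffel1 h p y x z w - derive_christoffel1 h p x y z w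
  + inner (G (F p)) (hessian p y z) (hessian p x w)
  - inner (G (F p)) (hessian p x z) (hessian p y w) =
  inner (G (F p)) (curv G (cst ('D_x F p)) (cst ('D_y F p)) (cst ('D_z F p))
    (F p))
    ('D_w F p).
Proof.
move=> Up; have WF := ls_maps ls Up.
have hessE a b c d : inner (G (F p)) (hessian p a b) (hessian p c d) =
    inner (G (F p)) (christoffel G (F p) ('D_a F p) ('D_b F p))
      (christoffel G (F p) ('D_c F p) ('D_d F p))
    + (christoffel1 G (F p) ('D_a F p) ('D_b F p) ('D_c ('D_d F) p)
       + christoffel1 G (F p) ('D_c F p) ('D_d F p) ('D_a ('D_b F) p)
       + inner (G (F p)) ('D_a ('D_b F) p) ('D_c ('D_d F) p)).
  have gen (u v u' v' : 'rV[R]_n) : inner (G (F p)) (u + u') (v + v') =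
      inner (G (F p)) u v + (inner (G (F p)) u v' + inner (G (F p)) v u'
                             + inner (G (F p)) u' v').
    by rewrite innerDl !innerDr (inner_tgtC v u' Up) !addrA.
  apply: etrans (gen _ _ _ _) _.
  by congr (_ + (_ + _ + _)); exact: inner_christoffel_tgt.
rewrite (inner_curv_cst _ _ _ _ oW sG (ls_sym_tgt ls) (ls_unit_tgt ls) WF).
have alg := @pullback_curvature_algebra R 'rV[R]_m 'rV[R]_n
  (inner (G (F p))) (fun a => inner ('D_a G (F p)))
  (fun a b => inner ('D_a ('D_b G) (F p)))
  (fun i => 'D_i F p) (fun i j => 'D_i ('D_j F) p)
  (fun i j k => 'D_i ('D_j ('D_k F)) p)
  (fun i j => inner ('D_i ('D_j h) p)) x y z w
  (fun u v => inner_tgtC u v Up)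
  (fun a u v => inner_derive_tgtC a u v Up)
  (fun a b u v => inner_sym u v (derive2_gram_sym a b oW sG (ls_sym_tgt ls) WF))
  (fun i j => smooth_derive_swap j i oU sF Up)
  (fun i j k => derive3_swap12 i j k Up)
  (fun i j k => derive3_swap23 i j k Up)
  (fun i j k l => inner_derive2_pullback i j k l Up).
have rearrange (a b c d e e' k k' s s' : R) : s = k + e -> s' = k' + e' ->
    a - b + e - e' = c - d -> a - b + s - s' = c - d + k - k'.
  by move=> -> -> <-; ring.
exact: rearrange (hessE y z x w) (hessE x z y w) alg.
Qed.

End PullbackCurvature.

(* In the notation of [oneill_curvature] below: [b i j k l] is the scalar
   product of [vshape p i j] and [vshape p k l], and [k2] the second derivative
   of [vertical]. *)
Lemma vertical_curvature_algebra (R : realType) (I : Type)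
    (b : I -> I -> I -> I -> R) (k2 : I -> I -> I -> I -> R) (x y z w : I) :
  (forall i j k l, b i j k l = b k l i j) ->
  k2 y x z w = b x z y w + b y z x w -> k2 y z x w = b z x y w + b y x z w ->
  k2 y w x z = b w x y z + b y x w z -> k2 x y z w = b y z x w + b x z y w ->
  k2 x z y w = b z y x w + b x y z w -> k2 x w y z = b w y x z + b x y w z ->
  let s i j k l := 4^-1 * (b i j k l + b i j l k + b j i k l + b j i l k) in
  let a i j k l := 4^-1 * (b i j k l - b i j l k - b j i k l + b j i l k) in
  2^-1 * (k2 y x z w + k2 y z x w - k2 y w x z)
  - 2^-1 * (k2 x y z w + k2 x z y w - k2 x w y z) + s y z x w - s x z y w =
  a x y z w + a y z x w + a z x y w - 3 * a x y z w.
Proof.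
move=> bC E1 E2 E3 E4 E5 E6 s a; rewrite /s /a E1 E2 E3 E4 E5 E6.
(* The exchange symmetry of [b] is built into its expression, so that [field] can use it. *)
have [t tE] : exists t, forall i j k l, b i j k l = t i j k l + t k l i j.
  exists (fun i j k l => 2^-1 * b i j k l) => i j k l.
  by rewrite (bC k l i j); field.
by rewrite !tE; field.
Qed.

(** * O'Neill's formula in coordinates *)

Section ONeill.
Context (R : realType) (m n : nat) (U : set 'rV[R]_m) (W : set 'rV[R]_n)
  (Gb : 'rV[R]_m -> 'M[R]_m) (G : 'rV[R]_n -> 'M[R]_n)
  (F : 'rV[R]_m -> 'rV[R]_n) (ls : local_submersion U W Gb G F).

Let oU := ls_open_src ls.
Let h := pullback G F.
Let K := vertical Gb G F.
Let L (p : 'rV[R]_m) : 'M[R]_m := invmx (Gb p).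

(* For horizontal [u] and [v], [vshape p u v - vshape p v u] is, up to sign,
   twice the O'Neill tensor A_u v, lowered to a covector by the metric. *)
Definition vshape (p u v : 'rV[R]_m) : 'rV[R]_m := v *m 'D_u K p.

Definition oneill_form (p x y z w : 'rV[R]_m) : R :=
  4^-1 * inner (L p) (vshape p x y - vshape p y x) (vshape p z w
    - vshape p w z).

Lemma vshape_vertical p u v : U p -> v *m K p = 0 ->
  vshape p u v *m L p *m K p = vshape p u v.
Proof. by move=> Up vK; rewrite -(derive_vertical_horizontal ls u Up vK). Qed.

Lemma derive_srcE p u : U p -> 'D_u Gb p = 'D_u h p + 'D_u K p.
Proof.
move=> Up.
have dGb := smooth_differentiable (ls_smooth_src ls) Up.
have dh := smooth_differentiable (smooth_pullback ls) Up.
have -> : 'D_u K p = 'D_u Gb p - 'D_u h p.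
  by apply: (deriveB (f := Gb) (g := h)); exact: diff_derivable.
by rewrite addrC subrK.
Qed.

Lemma derive2_srcE p u v : U p ->
  'D_u ('D_v Gb) p = 'D_u ('D_v h) p + 'D_u ('D_v K) p.
Proof.
move=> Up; have nU : nbhs p U by exact: open_nbhs_nbhs.
have ddh := smooth_differentiable (smooth_derive v (smooth_pullback ls)) Up.
have ddK := smooth_differentiable (smooth_derive v (smooth_vertical ls)) Up.
rewrite -(deriveD (diff_derivable ddh) (diff_derivable ddK)).
apply: near_eq_derive; apply: filterS nU => q Uq; exact: derive_srcE.
Qed.

Lemma derive_christoffel1_src p x u v w : U p ->
  derive_christoffel1 Gb p x u v w =
  derive_christoffel1 h p x u v w + derive_christoffel1 K p x u v w.
Proof.
move=> Up; have E a c d : inner ('D_x ('D_a Gb) p) c d =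
    inner ('D_x ('D_a h) p) c d + inner ('D_x ('D_a K) p) c d.
  by rewrite derive2_srcE// innerDm.
have alg (a b c a1 b1 c1 a2 b2 c2 : R) : a = a1 + a2 -> b = b1 + b2 ->
    c = c1 + c2 -> 2^-1 * (a + b - c) =
    2^-1 * (a1 + b1 - c1) + 2^-1 * (a2 + b2 - c2).
  by move=> -> -> ->; ring.
exact: alg.
Qed.

(** On horizontal [u] and [v] the derivative of [K] along any [w] vanishes, which removes the third
    Koszul term. The lowered Christoffel vector then has a part pulled back from the base and a part
    that annihilates horizontal vectors. *)
Lemma christoffel1_src p u v w : U p -> u *m K p = 0 -> v *m K p = 0 ->
  christoffel1 Gb p u v w =
  ((hessian G F p u v *m G (F p) *m ('J F p)^T
    + 2^-1 *: (vshape p u v + vshape p v u)) *m w^T) 0 0.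
Proof.
move=> Up uK vK; have E a c d : inner ('D_a Gb p) c d =
    inner ('D_a h p) c d + inner ('D_a K p) c d.
  by rewrite derive_srcE// innerDm.
have alg (a b c a1 b1 c1 a2 b2 c2 : R) : a = a1 + a2 -> b = b1 + b2 ->
    c = c1 + c2 -> c2 = 0 -> 2^-1 * (a + b - c) =
    2^-1 * (a1 + b1 - c1) + 2^-1 * (a2 + b2).
  by move=> -> -> -> ->; ring.
have Kuv : inner ('D_w K p) u v = 0.
  have := inner_derive_vertical ls w u v Up; rewrite -/K uK vK => ->.
  by rewrite !inner0l inner0r !addr0.
apply: etrans (alg _ _ _ _ _ _ _ _ _ (E _ _ _) (E _ _ _) (E _ _ _) Kuv) _.
rewrite mulmxDl [RHS]mxE; congr (_ + _).
  rewrite [LHS](christoffel1_pullback ls u v w Up) /inner.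
  rewrite (derive_jacobian ls w Up) trmx_mul !mulmxA.
  by [].
by rewrite -scalemxAl mulmxDl [RHS]mxE [X in _ = _ * X]mxE.
Qed.

Lemma christoffel_src p u v : U p -> u *m K p = 0 -> v *m K p = 0 ->
  christoffel Gb p u v =
  (hessian G F p u v *m G (F p) *m ('J F p)^T
    + 2^-1 *: (vshape p u v + vshape p v u)) *m L p.
Proof.
move=> Up uK vK; rewrite christoffelE; congr (_ *m _); apply/rowP => k.
rewrite [LHS]mxE (christoffel1_src _ Up uK vK).
by rewrite trmx_delta -colE [LHS]mxE.
Qed.

(** Raising an index is an isometry for the metric induced on covectors. Pulled-back covectors are
    orthogonal to [s] and [s'] because horizontal lifts are annihilated by [K], and among themselves
    they have the products of the base by [cometric_inv]. *)
Lemma inner_src_split p (b b' : 'rV[R]_n) (s s' : 'rV[R]_m) : U p ->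
  s *m L p *m K p = s -> s' *m L p *m K p = s' ->
  inner (Gb p) ((b *m G (F p) *m ('J F p)^T + s) *m L p)
    ((b' *m G (F p) *m ('J F p)^T + s') *m L p) =
  inner (G (F p)) b b' + inner (L p) s s'.
Proof.
move=> Up sE sE'; have uGb := ls_unit_src ls Up.
have KT := vertical_sym ls Up; have LT := inverse_sym ls Up.
have liftK := lift_vertical ls Up.
have LL (c c' : 'rV[R]_m) : inner (Gb p) (c *m L p) (c' *m L p) =
    inner (L p) c c'.
  by rewrite /inner mulmxKV// trmx_mul LT !mulmxA.
have bs (d : 'rV[R]_n) (t : 'rV[R]_m) : t *m L p *m K p = t ->
    inner (L p) (d *m G (F p) *m ('J F p)^T) t = 0.
  move=> <-; rewrite /inner !trmx_mul KT LT.
  transitivity ((d *m (horizontal_lift Gb G F p *m K p) *m (L p *m t^T)) 0 0).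
    by rewrite /horizontal_lift !mulmxA.
  by rewrite liftK mulmx0 mul0mx mxE.
have bb :
    inner (L p) (b *m G (F p) *m ('J F p)^T) (b' *m G (F p) *m ('J F p)^T) =
    inner (G (F p)) b b'.
  rewrite /inner !trmx_mul trmxK (ls_sym_tgt ls (ls_maps ls Up)).
  have := cometric_inv ls Up; rewrite -/(L p) => co.
  transitivity ((b *m (G (F p) *m (('J F p)^T *m L p *m 'J F p)) *m G (F p)
    *m b'^T) 0 0).
    by rewrite !mulmxA.
  by rewrite co mulmx1.
rewrite LL innerDl !innerDr bb (bs b s' sE').
by rewrite (inner_sym s _ LT) (bs b' s sE) addr0 add0r.
Qed.

Lemma inner_christoffel_src p u v u' v' : U p ->
  u *m K p = 0 -> v *m K p = 0 -> u' *m K p = 0 -> v' *m K p = 0 ->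
  inner (Gb p) (christoffel Gb p u v) (christoffel Gb p u' v') =
  inner (G (F p)) (hessian G F p u v) (hessian G F p u' v')
  + 4^-1 * inner (L p) (vshape p u v + vshape p v u)
                       (vshape p u' v' + vshape p v' u').
Proof.
move=> Up uK vK uK' vK'.
rewrite (christoffel_src Up uK vK) (christoffel_src Up uK' vK').
have sumE (a c : 'rV[R]_m) : a *m L p *m K p = a -> c *m L p *m K p = c ->
    (2^-1 *: (a + c)) *m L p *m K p = 2^-1 *: (a + c).
  by move=> aE cE; rewrite -2!scalemxAl mulmxDl mulmxDl aE cE.
have sE := sumE _ _ (vshape_vertical u Up vK) (vshape_vertical v Up uK).
have sE' := sumE _ _ (vshape_vertical u' Up vK') (vshape_vertical v' Up uK').
apply: etrans (inner_src_split _ _ Up sE sE') _; congr (_ + _).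
have half2 (M : 'M[R]_m) (a c : 'rV[R]_m) :
    inner M (2^-1 *: a) (2^-1 *: c) = 4^-1 * inner M a c.
  by rewrite innerZl innerZr; field.
exact: half2.
Qed.

(** Subtracting [pullback_curvature] from [inner_curv_cst] upstairs leaves only terms in [K]. The
    symmetric part of [vshape] occurs both in its second derivatives and in the products of
    Christoffel vectors, and the two contributions cancel. *)
Lemma oneill_curvature p x y z w : U p ->
  x *m K p = 0 -> y *m K p = 0 -> z *m K p = 0 -> w *m K p = 0 ->
  inner (G (F p)) (curv G (cst ('D_x F p)) (cst ('D_y F p)) (cst ('D_z F p))
    (F p))
    ('D_w F p) =
  inner (Gb p) (curv Gb (cst x) (cst y) (cst z) p) w
  + 3 * oneill_form p x y z w
  - (oneill_form p x y z w + oneill_form p y z x w + oneill_form p z x y w).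
Proof.
move=> Up xK yK zK wK.
have LT := inverse_sym ls Up.
pose b i j k l := inner (L p) (vshape p i j) (vshape p k l).
have bC i j k l : b i j k l = b k l i j by exact: inner_sym.
pose k2 i j k l := inner ('D_i ('D_j K) p) k l.
have kE i j k l : k *m K p = 0 -> l *m K p = 0 ->
    k2 i j k l = b j k i l + b i k j l.
  by move=> kK lK; exact: (inner_derive2_vertical ls i j Up kK lK).
have alg := @vertical_curvature_algebra R 'rV[R]_m b k2 x y z w bC
  (kE y x z w zK wK) (kE y z x w xK wK) (kE y w x z xK zK)
  (kE x y z w zK wK) (kE x z y w yK wK) (kE x w y z yK zK).
have sE i j k l : 4^-1 * inner (L p) (vshape p i j + vshape p j i)
      (vshape p k l + vshape p l k) =
    4^-1 * (b i j k l + b i j l k + b j i k l + b j i l k).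
  have gen (M : 'M[R]_m) (a c a' c' : 'rV[R]_m) : inner M (a + c) (a' + c') =
      inner M a a' + inner M a c' + inner M c a' + inner M c c'.
    by rewrite innerDl !innerDr addrA.
  by congr (_ * _); exact: gen.
have aE i j k l : oneill_form p i j k l =
    4^-1 * (b i j k l - b i j l k - b j i k l + b j i l k).
  have gen (M : 'M[R]_m) (a c a' c' : 'rV[R]_m) : inner M (a - c) (a' - c') =
      inner M a a' - inner M a c' - inner M c a' + inner M c c'.
    by rewrite innerDl !innerDr !innerNl !innerNr opprK addrA.
  by congr (_ * _); exact: gen.
have pc := pullback_curvature ls x y z w Up.
have gauss : inner (Gb p) (curv Gb (cst x) (cst y) (cst z) p) w =
  derive_christoffel1 Gb p y x z w - derive_christoffel1 Gb p x y z w
  + inner (Gb p) (christoffel Gb p y z) (christoffel Gb p x w)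
  - inner (Gb p) (christoffel Gb p x z) (christoffel Gb p y w).
  exact: (inner_curv_cst x y z w oU (ls_smooth_src ls) (ls_sym_src ls)
    (ls_unit_src ls) Up).
have combine (r rb d d' h1 h1' k1 k1' e e' f f' s s' c c' a1 a2 a3 : R) :
  rb = d - d' + e - e' -> d = h1 + k1 -> d' = h1' + k1' ->
  e = f + s -> e' = f' + s' -> h1 - h1' + f - f' = r ->
  s = c -> s' = c' ->
  k1 - k1' + c - c' = a1 + a2 + a3 - 3 * a1 ->
  r = rb + 3 * a1 - (a1 + a2 + a3).
  move=> -> -> -> -> -> <- -> -> E.
  have -> : k1 = k1' - c + c' + (a1 + a2 + a3 - 3 * a1) by rewrite -E; ring.
  by ring.
apply: (combine _ _ _ _ _ _ _ _ _ _ _ _ _ _ _ _ _ _ _ gauss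
  (derive_christoffel1_src y x z w Up) (derive_christoffel1_src x y z w Up)
  (inner_christoffel_src Up yK zK xK wK) (inner_christoffel_src Up xK zK yK wK)
  pc (sE _ _ _ _) (sE _ _ _ _)).
by rewrite !aE; exact: alg.
Qed.

End ONeill.

(** * Operators on bivectors *)

Lemma half_double (R : realType) (V : lmodType R) (a : V) :
  2^-1 *: (a + a) = a.
Proof. by rewrite -mulr2n -[a *+ 2]scaler_nat scalerA mulVf ?scale1r. Qed.

Lemma wedgeC (R : realType) (n : nat) (x y : 'rV[R]_n) :
    wedge y x = - wedge x y.
Proof. by rewrite /wedge opprB. Qed.

Lemma wedgeDl (R : realType) (n : nat) (a : R) (x x' y : 'rV[R]_n) :
  wedge (a *: x + x') y = a *: wedge x y + wedge x' y.
Proof.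
rewrite /wedge linearP /= mulmxDl mulmxDr -scalemxAl -scalemxAr scalerBr.
by rewrite opprD addrACA.
Qed.

Lemma bivector_sum_wedge (R : realType) (n : nat) (A : 'M[R]_n) : bivector A ->
  A = 2^-1 *: \sum_i \sum_j A i j *: wedge (delta_mx 0 i) (delta_mx 0 j).
Proof.
move=> skewA.
have -> : \sum_i \sum_j A i j *: wedge (delta_mx 0 i) (delta_mx 0 j) = A - A^T.
  rewrite [in RHS](matrix_sum_delta A) linear_sum -sumrB /=.
  apply: eq_bigr => i _; rewrite linear_sum -sumrB /=; apply: eq_bigr => j _.
  by rewrite linearZ /= /wedge !trmx_delta !mul_delta_mx scalerBr.
by rewrite skewA opprK half_double.
Qed.

Lemma bivector_ext (R : realType) (n : nat) (V : lmodType R)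
    (f g : 'M[R]_n -> V) : linear f -> linear g ->
  (forall x y, f (wedge x y) = g (wedge x y)) ->
  forall A, bivector A -> f A = g A.
Proof.
move=> lf lg fg A /bivector_sum_wedge ->.
pose fM := GRing.isLinear.Build _ _ _ _ _ lf.
pose gM := GRing.isLinear.Build _ _ _ _ _ lg.
pose fL : {linear _ -> _} := HB.pack f fM.
pose gL : {linear _ -> _} := HB.pack g gM.
rewrite -[f _]/(fL _) -[g _]/(gL _) !linearZ !linear_sum; congr (_ *: _).
apply: eq_bigr => i _; rewrite !linear_sum; apply: eq_bigr => j _.
by rewrite !linearZ; congr (_ *: _); exact: fg.
Qed.

Lemma linear_row_sum (R : realType) (n : nat) (V : lmodType R)
    (f : 'rV[R]_n -> V) (u : 'rV[R]_n) :
  linear f -> f u = \sum_i u 0 i *: f (delta_mx 0 i).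
Proof.
move=> lf; pose fM := GRing.isLinear.Build _ _ _ _ _ lf.
pose fL : {linear _ -> _} := HB.pack f fM.
rewrite -[f u]/(fL u) [in LHS](row_sum_delta u) linear_sum.
by apply: eq_bigr => i _; rewrite linearZ.
Qed.

(* The universal property of Lambda^2. *)
Lemma wedge_lift (R : realType) (n : nat) (V : lmodType R)
    (v : 'rV[R]_n -> 'rV[R]_n -> V) :
  (forall y, linear (v^~ y)) -> (forall x y, v x y = - v y x) ->
  exists T : {linear 'M[R]_n -> V}, forall x y, T (wedge x y) = v x y.
Proof.
move=> lv vC.
pose t (A : 'M[R]_n) : V :=
  2^-1 *: \sum_i \sum_j A i j *: v (delta_mx 0 i) (delta_mx 0 j).
have lt : linear t.
  move=> a A B; rewrite /t scalerA mulrC -scalerA -scalerDr; congr (_ *: _).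
  rewrite scaler_sumr -big_split; apply: eq_bigr => i _.
  rewrite scaler_sumr -big_split; apply: eq_bigr => j _.
  by rewrite !mxE scalerDl scalerA.
pose tM := GRing.isLinear.Build _ _ _ _ _ lt.
pose tL : {linear _ -> _} := HB.pack t tM.
exists tL => x y; rewrite -[tL _]/(t _) /t.
have lv2 a : linear (v a).
  by move=> k b c; rewrite !(vC a) lv opprD scalerN.
have vE a b : v a b = \sum_i \sum_j (a 0 i
    * b 0 j) *: v (delta_mx 0 i) (delta_mx 0 j).
  rewrite (linear_row_sum a (lv b)); apply: eq_bigr => i _.
  rewrite (linear_row_sum b (lv2 _)) scaler_sumr; apply: eq_bigr => j _.
  by rewrite scalerA.
have -> : \sum_i \sum_j wedge x y i j *: v (delta_mx 0 i) (delta_mx 0 j) =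
    v x y - v y x.
  rewrite (vE x y) (vE y x) -sumrB; apply: eq_bigr => i _.
  rewrite -sumrB; apply: eq_bigr => j _; rewrite -scalerBl; congr (_ *: _).
  by rewrite /wedge !mxE !big_ord1 !mxE.
by rewrite (vC y x) opprK half_double.
Qed.

(* Encodes a bilinear form on bivectors by its values on simple ones. *)
Record biform (R : realType) (n : nat)
    (Q : 'rV[R]_n -> 'rV[R]_n -> 'rV[R]_n -> 'rV[R]_n -> R) : Prop := Biform {
  biform_lin1 : forall y z w, scalar (fun x => Q x y z w);
  biform_lin3 : forall x y w, scalar (fun z => Q x y z w);
  biform_skew12 : forall x y z w, Q x y z w = - Q y x z w;
  biform_skew34 : forall x y z w, Q x y z w = - Q x y w z }.

Lemma inner2DZl (R : realType) (n : nat) (G A A' B : 'M[R]_n) (a : R) :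
  inner2 G (a *: A + A') B = a * inner2 G A B + inner2 G A' B.
Proof.
rewrite /inner2 mulmxDr !mulmxDl linearD /= -scalemxAr -!scalemxAl linearZ /=.
by ring.
Qed.

Lemma inner2C (R : realType) (n : nat) (G A B : 'M[R]_n) : G^T = G ->
  inner2 G A B = inner2 G B A.
Proof.
move=> symG; rewrite /inner2 -mxtrace_tr !trmx_mul symG trmxK.
by rewrite !mulmxA mxtrace_mulC !mulmxA.
Qed.

Lemma inner2DZr (R : realType) (n : nat) (G A B B' : 'M[R]_n) (a : R) :
  inner2 G A (a *: B + B') = a * inner2 G A B + inner2 G A B'.
Proof.
rewrite /inner2 linearP /= mulmxDr linearD /= -scalemxAr linearZ /=.
by ring.
Qed.

Lemma biform_operator (R : realType) (n : nat) (G : 'M[R]_n) Q T :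
  operator_of G Q T -> biform Q.
Proof.
move=> [_ QE]; split=> [y z w k x x'|x y w k z z'|x y z w|x y z w];
  rewrite -!QE.
- by rewrite wedgeDl linearP inner2DZl.
- by rewrite wedgeDl inner2DZr.
- rewrite (wedgeC y x) linearN -[X in inner2 _ X]addr0 -scaleN1r inner2DZl.
  by rewrite mulN1r /inner2 mulmx0 !mul0mx mxtrace0 mulr0 addr0.
- rewrite (wedgeC w z) -[- _]addr0 -scaleN1r inner2DZr.
  by rewrite mulN1r /inner2 trmx0 mulmx0 mxtrace0 mulr0 addr0.
Qed.

Lemma operator_exists (R : realType) (n : nat) (G : 'M[R]_n) Q :
  G^T = G -> G \in unitmx -> biform Q ->
  exists T : {linear 'M[R]_n -> 'M[R]_n}, operator_of G Q T.
Proof.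
move=> symG uG [lin1 lin3 skew12 skew34].
pose q x y := \matrix_(k, l) Q x y (delta_mx 0 k) (delta_mx 0 l).
have ql y : linear (q^~ y).
  by move=> a x x'; apply/matrixP => k l; rewrite !mxE lin1.
have qC x y : q x y = - q y x by apply/matrixP => k l; rewrite !mxE skew12.
have qT x y : (q x y)^T = - q x y by apply/matrixP => k l; rewrite !mxE skew34.
have [qh qhE] := wedge_lift ql qC.
(* [qh A] is the 2-form that [Q] pairs with [A]; the two factors [invmx G] raise its indices, giving
   the bivector that represents it for [inner2 G]. *)
pose t A := invmx G *m qh A *m invmx G.
have lt : linear t.
  by move=> a A B; rewrite /t linearP mulmxDr mulmxDl -scalemxAr -scalemxAl.
pose tM := GRing.isLinear.Build _ _ _ _ _ lt.
pose tL : {linear _ -> _} := HB.pack t tM.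
have QE x y z w : (z *m q x y *m w^T) 0 0 = Q x y z w.
  have lin4 : scalar (Q x y z).
    by move=> a u u'; rewrite !(skew34 x y z) lin3 opprD mulrN.
  rewrite -[LHS]/(inner _ _ _) innerE.
  rewrite (linear_row_sum (V := R^o) z (lin3 x y w)).
  apply: eq_bigr => i _.
  have lin4i : scalar (Q x y (delta_mx 0 i)).
    by move=> a u u'; rewrite !(skew34 x y (delta_mx 0 i)) lin3 opprD mulrN.
  rewrite (linear_row_sum (V := R^o) w lin4i) scaler_sumr;
    apply: eq_bigr => j _.
  by rewrite mxE mulrAC -mulrA.
exists tL; split=> [A bA|x y z w]; rewrite -[tL _]/(t _) /t.
  rewrite /bivector !trmx_mul trmx_inv symG mulmxA -mulNmx -mulmxN.
  congr (_ *m _ *m _).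
  apply: (@bivector_ext _ _ _ (fun A => (qh A)^T) (fun A => - qh A)) bA.
  - by move=> a u u'; rewrite !linearP.
  - by move=> a u u'; rewrite linearP opprD scalerN.
  - by move=> x y; rewrite qhE qT.
rewrite qhE /inner2 !mulmxA mulmxV// mul1mx mulmxKV// /wedge.
rewrite linearB /= !trmx_mul !trmxK mulmxBr linearB /= !mulmxA.
rewrite mxtrace_mulC [X in _ - X]mxtrace_mulC !trace_mx11 !mulmxA !QE
  (skew34 _ _ w z).
by field.
Qed.

Lemma biform_lin2 (R : realType) (n : nat) Q : @biform R n Q ->
  forall x z w, scalar (fun y => Q x y z w).
Proof.
move=> [lin1 _ skew12 _] x z w a y y'.
by rewrite !(skew12 x) lin1 opprD mulrN.
Qed.

Lemma biform_lin4 (R : realType) (n : nat) Q : @biform R n Q ->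
  forall x y z, scalar (fun w => Q x y z w).
Proof.
move=> [_ lin3 _ skew34] x y z a w w'.
by rewrite !(skew34 x y z) lin3 opprD mulrN.
Qed.

Lemma biform_lincomb (R : realType) (n : nat) (a b : R) P Q :
  @biform R n P -> @biform R n Q ->
  biform (fun x y z w => a * P x y z w + b * Q x y z w).
Proof.
move=> [P1 P3 P12 P34] [Q1 Q3 Q12 Q34];
  split=> [y z w k x x'|x y w k z z'|x y z w|x y z w].
- by rewrite P1 Q1; ring.
- by rewrite P3 Q3; ring.
- by rewrite P12 Q12; ring.
- by rewrite P34 Q34; ring.
Qed.

Lemma biform_pullback (R : realType) (m n : nat) (H : 'M[R]_(n, m)) Q :
  biform Q ->
  biform (fun x y z w => Q (x *m H) (y *m H) (z *m H) (w *m H)).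
Proof.
move=> [lin1 lin3 skew12 skew34].
split=> [y z w k x x'|x y w k z z'|x y z w|x y z w].
- by rewrite mulmxDl -scalemxAl lin1.
- by rewrite mulmxDl -scalemxAl lin3.
- exact: skew12.
- exact: skew34.
Qed.

(** * Descent of positivity along horizontal lifts *)

Section Descent.
Context (R : realType) (m n : nat) (Gb L : 'M[R]_m) (G : 'M[R]_n)
  (H : 'M[R]_(n, m)) (J : 'M[R]_(m, n)) (v : 'rV[R]_n -> 'rV[R]_n -> 'rV[R]_m)
  (symGb : Gb^T = Gb) (symG : G^T = G) (uG : G \in unitmx)
  (symL : L^T = L) (posL : forall u, 0 <= inner L u u) (HJ : H *m J = 1%:M)
  (vl : forall y, linear (v^~ y)) (vC : forall x y, v x y = - v y x).

Let a x y z w := 4^-1 * inner L (v x y) (v z w).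

Let aP : biform a.
Proof.
split=> [y z w k x x'|x y w k z z'|x y z w|x y z w]; rewrite /a.
- by rewrite vl innerDl innerZl; ring.
- by rewrite vl innerDr innerZr; ring.
- by rewrite vC innerNl mulrN.
- by rewrite [v z w]vC innerNr mulrN.
Qed.

(** [a] is skew in each pair of arguments and invariant under exchanging the pairs. When two
    adjacent arguments coincide, one term of the cyclic sum vanishes and the other two cancel. *)
Lemma alternating4_cyclic_sum (w0 : 'rV[R]_m -> 'rV[R]_m -> 'rV[R]_m ->
    'rV[R]_m -> R) :
  alternating4 w0 ->
  alternating4 (fun x y z w => w0 (x *m H) (y *m H) (z *m H) (w *m H)
                + (a x y z w + a y z x w + a z x y w)).
Proof.
have [a1 a3 a12 a34] := aP; have a2 := biform_lin2 aP;
    have a4 := biform_lin4 aP.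
have aC x y z w : a x y z w = a z w x y by rewrite /a (inner_sym _ _ symL).
have aa x z w : a x x z w = 0.
  have := a12 x x z w; move/eqP; rewrite -addr_eq0 -mulr2n mulrn_eq0 /=.
  by move/eqP.
have aa' x z w : a z w x x = 0 by rewrite aC.
move=> [l1 l2 l3 l4 alt12 alt23 alt34]; split.
- by move=> y z w k x x'; rewrite mulmxDl -scalemxAl l1 a1 a3 a2; ring.
- by move=> x z w k y y'; rewrite mulmxDl -scalemxAl l2 a1 a3 a2; ring.
- by move=> x y w k z z'; rewrite mulmxDl -scalemxAl l3 a1 a3 a2; ring.
- by move=> x y z k w w'; rewrite mulmxDl -scalemxAl l4 !a4; ring.
- by move=> x z w; rewrite alt12 aa (a12 x z); ring.
- by move=> x y w; rewrite alt23 aa (a12 x y); ring.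
- by move=> x y z; rewrite alt34 aa' (aC z x) (a34 y z z x); ring.
Qed.

Lemma positive_descends (Rb w0 : 'rV[R]_m -> 'rV[R]_m -> 'rV[R]_m ->
    'rV[R]_m -> R)
    (Rm : 'rV[R]_n -> 'rV[R]_n -> 'rV[R]_n -> 'rV[R]_n -> R)
    (Rbop Wbop : {linear 'M[R]_m -> 'M[R]_m}) :
  alternating4 w0 -> operator_of Gb Rb Rbop -> operator_of Gb w0 Wbop ->
  positive_definite Gb (fun A => Rbop A + Wbop A) ->
  (forall x y z w, Rm x y z w = Rb (x *m H) (y *m H) (z *m H) (w *m H)
     + 3 * a x y z w - (a x y z w + a y z x w + a z x y w)) ->
  exists omega : 'rV[R]_n -> 'rV[R]_n -> 'rV[R]_n -> 'rV[R]_n -> R,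
  exists Rop Wop : {linear 'M[R]_n -> 'M[R]_n},
  [/\ alternating4 omega, operator_of G Rm Rop, operator_of G omega Wop
    & positive_definite G (fun A => Rop A + Wop A)].
Proof.
move=> altw RbE w0E [selfadj pos] RmE.
(* Adding [omega] to [Rm] leaves the pullback of [Rb + w0] plus the positive
   semidefinite [3 * a]. *)
pose c x y z w := a x y z w + a y z x w + a z x y w.
pose omega x y z w := w0 (x *m H) (y *m H) (z *m H) (w *m H) + c x y z w.
have alto : alternating4 omega by exact: alternating4_cyclic_sum.
have [a1 a3 a12 a34] := aP; have a2 := biform_lin2 aP;
    have a4 := biform_lin4 aP.
have aC x y z w : a x y z w = a z w x y by rewrite /a (inner_sym _ _ symL).
have cP : biform c.
  split.
  - by move=> y z w k x x'; rewrite /c a1 a3 a2; ring.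
  - by move=> x y w k z z'; rewrite /c a1 a3 a2; ring.
  - by move=> x y z w; rewrite /c a12 (a12 y z) (a12 z x); ring.
  - move=> x y z w; rewrite /c (a34 x y z w) (aC y z x w) (a12 x w y z).
    by rewrite (aC z x y w) (a34 y w z x); ring.
have omegaP : biform omega.
  have := biform_lincomb 1 1 (biform_pullback H (biform_operator w0E)) cP.
  by congr biform; do 4 apply/funext => ?; rewrite !mul1r.
have RmP : biform Rm.
  have RaP := biform_lincomb 1 3 (biform_pullback H (biform_operator RbE)) aP.
  have := biform_lincomb 1 (-1) RaP cP.
  by congr biform; do 4 apply/funext => ?; rewrite RmE !mul1r mulN1r.
have [Rop RopE] := operator_exists symG uG RmP.
have [Wop WopE] := operator_exists symG uG omegaP.
exists omega, Rop, Wop; split=> //.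
(* Nonnegativity of [a] is needed on all bivectors, not only on simple ones. It holds because [a] is
   a multiple of the form [L] pulled back by a single linear map on bivectors. *)
have [vh vhE] := wedge_lift vl vC.
pose lift (A : 'M[R]_n) : 'M[R]_m := H^T *m A *m H.
have liftD k A B : lift (k *: A + B) = k *: lift A + lift B.
  by rewrite /lift mulmxDr mulmxDl -scalemxAr -scalemxAl.
have lift_wedge x y : lift (wedge x y) = wedge (x *m H) (y *m H).
  by rewrite /lift /wedge mulmxBr mulmxBl !trmx_mul !mulmxA.
have lift_bivector A : bivector A -> bivector (lift A).
  by rewrite /bivector /lift !trmx_mul trmxK => ->;
    rewrite mulNmx mulmxN mulmxA.
have addP k (f g : {linear 'M[R]_k -> 'M[R]_k}) b A B :
    f (b *: A + B) + g (b *: A + B) = b *: (f A + g A) + (f B + g B).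
  by rewrite !linearP addrACA scalerDr.
(* Both sides are bilinear, so [bivector_ext], used once per argument, reduces the identity to
   simple bivectors, where the tensors give the operators. *)
have E A B : bivector A -> bivector B -> inner2 G (Rop A + Wop A) B =
    inner2 Gb (Rbop (lift A) + Wbop (lift A)) (lift B)
    + 3 * 4^-1 * inner L (vh A) (vh B).
  move=> bA; move: B; apply: (@bivector_ext _ _ R^o); first by move=> k B B';
    exact: inner2DZr.
    move=> k B B'; rewrite liftD inner2DZr linearP innerDr innerZr.
    by rewrite /GRing.scale /=; ring.
  move=> z w; move: A bA; apply: (@bivector_ext _ _ R^o).
  - by move=> k A A'; rewrite addP inner2DZl.
  - move=> k A A'; rewrite liftD addP inner2DZl linearP innerDl innerZl.
    by rewrite /GRing.scale /=; ring.
  - move=> x y; rewrite !lift_wedge !vhE.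
    have add2 k (M A A' B : 'M[R]_k) :
        inner2 M (A + A') B = inner2 M A B + inner2 M A' B.
      by rewrite -[A]scale1r inner2DZl mul1r scale1r.
    rewrite !add2 (RopE.2 x y z w) (WopE.2 x y z w) (RbE.2 _ _ _ _)
      (w0E.2 _ _ _ _).
    by rewrite RmE /omega /c /a; ring.
split=> [A B bA bB|A bA A0].
  rewrite E// (inner2C _ _ symG) E//; congr (_ + _ * _); last exact: inner_sym.
  by rewrite selfadj 1?(inner2C _ _ symGb)//; exact: lift_bivector.
rewrite E//; apply: ltr_wpDr; last apply: pos.
- by rewrite mulr_ge0// mulr_ge0// invr_ge0.
- exact: lift_bivector.
- apply: contra_neq A0 => liftA0.
  (* [J] undoes the lift, so a nonzero bivector has a nonzero lift. *)
  have : J^T *m lift A *m J = A.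
    rewrite /lift !mulmxA -trmx_mul HJ trmx1 mul1mx -mulmxA HJ mulmx1.
    by [].
  by rewrite liftA0 mulmx0 mul0mx.
Qed.

End Descent.

(** * Charts and the pointwise conclusion *)

Lemma inner_delta (R : realType) (n : nat) (A : 'M[R]_n) i j :
  inner A (delta_mx 0 i) (delta_mx 0 j) = A i j.
Proof. by rewrite /inner trmx_delta -rowE -colE !mxE. Qed.

Lemma posdef_unitmx (R : realType) (n : nat) (G : 'M[R]_n) :
  (forall v, v != 0 -> 0 < inner G v v) -> G \in unitmx.
Proof.
move=> posG; rewrite -row_free_unit -kermx_eq0; apply/eqP/row_matrixP => i.
rewrite row0; apply/eqP; apply: contraT => /posG.
have /sub_kermxP : (row i (kermx G) <= kermx G)%MS by exact: row_sub.
by rewrite /inner => ->; rewrite mul0mx mxE ltxx.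
Qed.

Lemma inner_invmx_ge0 (R : realType) (n : nat) (G : 'M[R]_n) (u : 'rV[R]_n) :
  G^T = G -> (forall v, v != 0 -> 0 < inner G v v) ->
  0 <= inner (invmx G) u u.
Proof.
move=> symG posG; have uG := posdef_unitmx posG.
have -> : inner (invmx G) u u = inner G (u *m invmx G) (u *m invmx G).
  by rewrite /inner mulmxKV// trmx_mul trmx_inv symG mulmxA.
by have [->|/posG/ltW//] := eqVneq (u *m invmx G) 0; rewrite inner0l.
Qed.

(** The vectors [w *m D^T *m L] are horizontal, and the isometry condition on them reads
    [S G S = S], where [S] is the metric that [Gb] induces on covectors of the base. Surjectivity of
    [D] makes [S] invertible. *)
Lemma cometric_of_submersion (R : realType) (m n : nat) (Gb : 'M[R]_m)
    (G : 'M[R]_n) (D : 'M[R]_(m, n)) :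
  Gb^T = Gb -> (forall v, v != 0 -> 0 < inner Gb v v) ->
  (forall w : 'rV[R]_n, exists v : 'rV[R]_m, v *m D = w) ->
  (forall u v : 'rV[R]_m,
     (forall k : 'rV[R]_m, k *m D = 0 -> inner Gb u k = 0) ->
     (forall k : 'rV[R]_m, k *m D = 0 -> inner Gb v k = 0) ->
     inner G (u *m D) (v *m D) = inner Gb u v) ->
  D^T *m invmx Gb *m D *m G = 1%:M.
Proof.
move=> symGb posGb surj iso; have uGb := posdef_unitmx posGb.
set L := invmx Gb; set S := D^T *m L *m D.
have LT : L^T = L by rewrite trmx_inv symGb.
have ST : S^T = S by rewrite /S !trmx_mul trmxK LT mulmxA.
have inner_hor (w : 'rV[R]_n) (v : 'rV[R]_m) :
    inner Gb (w *m D^T *m L) v = (w *m (v *m D)^T) 0 0.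
  by rewrite /inner mulmxKV// trmx_mul mulmxA.
have hor (w : 'rV[R]_n) (k : 'rV[R]_m) :
    k *m D = 0 -> inner Gb (w *m D^T *m L) k = 0.
  by move=> kD; rewrite inner_hor kD trmx0 mulmx0 mxE.
have SGS : S *m G *m S = S.
  have E (w w' : 'rV[R]_n) : (w *m (S *m G *m S) *m w'^T) 0 0 =
      (w *m S *m w'^T) 0 0.
    transitivity (inner G (w *m D^T *m L *m D) (w' *m D^T *m L *m D)).
      by rewrite /inner /S !trmx_mul !trmxK LT !mulmxA.
    rewrite (iso _ _ (hor w) (hor w')) inner_hor !trmx_mul trmxK LT /S.
    by rewrite !mulmxA.
  apply/matrixP => i j; have := E (delta_mx 0 i) (delta_mx 0 j).
  by rewrite !trmx_delta -!rowE -!colE !mxE.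
have uS : S \in unitmx.
  rewrite -row_free_unit -kermx_eq0; apply/eqP/row_matrixP => i; rewrite row0.
  have /sub_kermxP : (row i (kermx S) <= kermx S)%MS by exact: row_sub.
  move: (row i _) => w wS.
  have wDL : w *m D^T *m L = 0.
    apply/eqP; apply: contraT => /posGb; rewrite inner_hor.
    have -> : w *m (w *m D^T *m L *m D)^T = w *m S *m w^T.
      by rewrite !trmx_mul !trmxK LT /S !mulmxA.
    by rewrite wS mul0mx mxE ltxx.
  apply/rowP => j; have [v vD] := surj (delta_mx 0 j).
  have := inner_hor w v; rewrite wDL inner0l vD trmx_delta -colE !mxE.
  by [].
by rewrite -[S *m G](mulmxK uS) SGS mulmxV.
Qed.

Lemma smooth_on_subset (R : realType) (V W : normedModType R)
    (U U' : set V) (f : V -> W) : U `<=` U' -> smooth_on U' f -> smooth_on U f.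
Proof.
move=> UU' /smooth_onP sf; apply/smooth_onP => k; move: (sf k).
elim: k f {sf} => [//|k IHk] f [df ddf]; split=> [x /UU'|v]; first exact: df.
by apply: IHk; exact: ddf.
Qed.

(** [coord] and [param] are meaningful only on their domains, so expressions in different charts
    agree with composites only near a point. *)
Lemma diff_comp_near (R : realType) (V1 V2 V3 : normedModType R)
    (f : V1 -> V2) (g : V2 -> V3) (k : V1 -> V3) (x v : V1) :
  differentiable f x -> differentiable g (f x) ->
  {near x, g \o f =1 k} -> 'd k x v = 'd g (f x) ('d f x v).
Proof.
move=> df dg gfk.
have dgf := differentiable_comp df dg.
have := near_eq_is_diff gfk dgf => dk.
by rewrite (@diff_val _ _ _ _ _ _ _ dk) (diff_comp df dg).
Qed.

Section Charts.
Context (R : realType) (n : nat) (M : manifold R n).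
Implicit Types c d : chart R n M.

Lemma open_param c (D : set M) :
  open D -> open [set x | img c x /\ D (param c x)].
Proof.
move=> oD; rewrite openE => x [cx Dx]; apply: filterI.
  by apply: open_nbhs_nbhs; split=> //; exact: img_open.
apply: (param_continuous cx); exact: open_nbhs_nbhs.
Qed.

Lemma transition_differentiable c d x : atlas c -> atlas d ->
  img c x -> dom d (param c x) -> differentiable (coord d \o param c) x.
Proof.
move=> ac ad cx dx.
by apply: (smooth_differentiable (atlas_smooth ac ad)).
Qed.

Lemma near_param c (D : set M) x : open D -> img c x -> D (param c x) ->
  \forall y \near x, img c y /\ D (param c y).
Proof. by move=> oD cx Dx; apply: open_nbhs_nbhs; split=> //;
  exact: open_param. Qed.

Lemma transition_inverse c d x v : atlas c -> atlas d ->
  img c x -> dom d (param c x) ->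
  'd (coord c \o param d) (coord d (param c x)) ('d (coord d \o param c) x v) =
    v.
Proof.
move=> ac ad cx dx.
rewrite -(@diff_comp_near _ _ _ _ (coord d \o param c) (coord c \o param d) id).
- by rewrite diff_val.
- exact: transition_differentiable.
- apply: transition_differentiable => //=; first exact: coord_img.
  by rewrite coordK//; exact: param_dom.
- apply: filterS (near_param (dom_open d) cx dx) => y [cy dy] /=.
  by rewrite coordK// paramK.
Qed.

(** [q] is a variable with an equation because [chart_at q] depends on it: equal points can be
    exchanged without rewriting under a differential. *)
Lemma inner_coord_gram (gram : M -> 'M[R]_n) c x q u v : param c x = q ->
  inner (coord_gram gram c x) u v =
  inner (gram q) ('d (coord (chart_at q) \o param c) x u)
                 ('d (coord (chart_at q) \o param c) x v).
Proof.
move=> <-; rewrite /coord_gram.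
move: ('d _ x) => J; pose B := lin1_mx J.
have JB w : J w = w *m B by rewrite mul_rV_lin1.
have -> : (\matrix_(i, j)
      inner (gram (param c x)) (J (delta_mx 0 i)) (J (delta_mx 0 j)))
    = B *m gram (param c x) *m B^T.
  apply/matrixP => i j; rewrite mxE !JB -[RHS]inner_delta /inner trmx_mul.
  by rewrite !mulmxA.
by rewrite !JB /inner trmx_mul !mulmxA.
Qed.

Lemma transition_injective c x v w : atlas c -> img c x ->
  'd (coord (chart_at (param c x)) \o param c) x v =
  'd (coord (chart_at (param c x)) \o param c) x w -> v = w.
Proof.
move=> ac cx vw; have aq := chart_at_atlas (param c x).
have dq := chart_at_dom (param c x).
exact: etrans (esym (transition_inverse v ac aq cx dq))
  (etrans (congr1 _ vw) (transition_inverse w ac aq cx dq)).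
Qed.

Lemma transition_surjective c x u : atlas c -> img c x ->
  exists v, 'd (coord (chart_at (param c x)) \o param c) x v = u.
Proof.
move=> ac cx; set q := param c x; have aq := chart_at_atlas q.
have dq := chart_at_dom q.
exists ('d (coord c \o param (chart_at q)) (coord (chart_at q) q) u).
have := @transition_inverse (chart_at q) c (coord (chart_at q) q) u aq ac
    (coord_img dq).
rewrite (coordK dq) (paramK cx); apply; exact: param_dom.
Qed.

Lemma coord_gram_sym (g : metric M) c x :
  (coord_gram (gram g) c x)^T = coord_gram (gram g) c x.
Proof. by apply/matrixP => i j; rewrite !mxE (inner_sym _ _
  (gram_sym g _)). Qed.

Lemma coord_gram_pos (g : metric M) c x v : atlas c -> img c x -> v != 0 ->
  0 < inner (coord_gram (gram g) c x) v v.
Proof.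
move=> ac cx v0; rewrite (inner_coord_gram _ _ _ (erefl _)); apply: gram_pos.
apply: contra_neq v0 => Jv0; apply: (transition_injective ac cx).
by rewrite Jv0 linear0.
Qed.

(** The transition from a preferred chart to itself is the identity near its centre. This links the
    local metrics with the matrices [gram] in [strongly_positive]. *)
Lemma coord_gram_center (gram : M -> 'M[R]_n) p :
  coord_gram gram (chart_at p) (coord (chart_at p) p) = gram p.
Proof.
have dp := chart_at_dom p.
apply/matrixP => i j; rewrite -[LHS]inner_delta -[RHS]inner_delta.
rewrite (inner_coord_gram _ _ _ (coordK dp)).
have J1 v :
    'd (coord (chart_at p) \o param (chart_at p)) (coord (chart_at p) p) v = v.
  have nid : {near coord (chart_at p) p,
      id =1 coord (chart_at p) \o param (chart_at p)}.
    have := near_param (dom_open (chart_at p)) (coord_img dp).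
    rewrite coordK// => /(_ dp); apply: filterS => y [cy _] /=.
    by rewrite paramK.
  have did : differentiable (id : 'rV[R]_n -> 'rV[R]_n) (coord (chart_at p) p).
    exact: ex_diff.
  have dk := near_eq_is_diff nid did.
  by rewrite (@diff_val _ _ _ _ _ _ _ dk) diff_val.
by rewrite !J1.
Qed.

End Charts.

(** * Riemannian submersions read in charts *)

Section Submersion.
Context (R : realType) (m n : nat) (Mbar : manifold R m) (gbar : metric Mbar)
  (M : manifold R n) (g : metric M) (f : Mbar -> M)
  (sub : riemannian_submersion gbar g f) (p : Mbar).

Let c : chart R m Mbar := chart_at p.
Let d : chart R n M := chart_at (f p).
Let U := [set x | img c x /\ dom d (f (param c x))].
Let F : 'rV[R]_m -> 'rV[R]_n := coord d \o f \o param c.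

Let f_smooth : smooth_map f. Proof. by case: sub. Qed.
Let ac : atlas c. Proof. exact: chart_at_atlas. Qed.
Let ad : atlas d. Proof. exact: chart_at_atlas. Qed.

Lemma chart_open : open U.
Proof.
apply: (@open_param _ _ _ c (f @^-1` dom d)).
by have /continuousP := f_smooth.1; apply; exact: dom_open.
Qed.

Lemma chart_smooth : smooth_on U F.
Proof. by case: f_smooth => _; apply. Qed.

(** [tangent_map] uses the preferred charts of the moving point, [F] the fixed charts [c] and [d].
    Both sides are the differential of the same mixed expression [k], factored in two ways. *)
Lemma tangent_map_chart x v : U x ->
  tangent_map f (param c x) ('d (coord (chart_at (param c x)) \o param c) x v) =
  'd (coord (chart_at (f (param c x))) \o param d) (F x) ('d F x v).
Proof.
move=> [cx dx]; set p' := param c x.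
have dp' := chart_at_dom p'; have dq' := chart_at_dom (f p').
have ac' : atlas (chart_at p') by exact: chart_at_atlas.
have ad' : atlas (chart_at (f p')) by exact: chart_at_atlas.
have [cf sf] := f_smooth.
have dpre (D : set M) : open D -> open (f @^-1` D).
  by move/continuousP: cf; apply.
pose k := coord (chart_at (f p')) \o f \o param c.
transitivity ('d k x v).
  apply/esym; apply: (@diff_comp_near _ _ _ _ (coord (chart_at p') \o param c)
    (coord (chart_at (f p')) \o f \o param (chart_at p')) k).
  - exact: transition_differentiable.
  - apply: (smooth_differentiable (sf _ _ ac' ad')) => /=.
    by rewrite coordK//; split=> //; exact: coord_img.
  - have := near_param (dom_open (chart_at p')) cx dp'.
    by apply: filterS => y [cy dy]; rewrite /k /= coordK.
apply: (@diff_comp_near _ _ _ _ F (coord (chart_at (f p')) \o param d) k).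
- exact: (smooth_differentiable chart_smooth).
- apply: transition_differentiable => //=; first exact: coord_img.
  by rewrite coordK.
- have := near_param (dpre _ (dom_open d)) cx dx.
  by apply: filterS => y [cy dy]; rewrite /k /= coordK.
Qed.

(** Differentials of chart changes are isomorphisms, and isometries by the construction of
    [coord_gram]; so the pointwise hypotheses in preferred charts carry over to [c] and [d]. *)
Lemma chart_cometric x : U x ->
  ('J F x)^T *m invmx (coord_gram (gram gbar) c x) *m 'J F x
    *m coord_gram (gram g) d (F x) = 1%:M.
Proof.
move=> Ux; have [cx dx] := Ux; set p' := param c x.
have JE v : v *m 'J F x = 'd F x v by rewrite /jacobian mul_rV_lin1.
have dF : img d (F x) by exact: coord_img.
have qE : param d (F x) = f p' by rewrite /F /= coordK.
have Jd_inj v w :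
    'd (coord (chart_at (f p')) \o param d) (F x) v =
    'd (coord (chart_at (f p')) \o param d) (F x) w -> v = w.
  by rewrite -qE; exact: transition_injective.
have [_ _ surj iso] := sub.
apply: cometric_of_submersion.
- exact: coord_gram_sym.
- by move=> v; exact: coord_gram_pos.
- move=> w.
  have [u uw] := surj p' ('d (coord (chart_at (f p')) \o param d) (F x) w).
  have [v vu] := transition_surjective u ac cx.
  exists v; rewrite JE; apply: Jd_inj.
  by rewrite -(tangent_map_chart v Ux) vu.
- move=> u v hu hv; rewrite !JE (inner_coord_gram _ _ _ qE).
  rewrite -!(tangent_map_chart _ Ux) (inner_coord_gram _ u v (erefl p')).
  have hor u' : (forall k, k *m 'J F x = 0 ->
      inner (coord_gram (gram gbar) c x) u' k = 0) ->
      forall k, tangent_map f p' k = 0 ->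
      inner (gram gbar p') ('d (coord (chart_at p') \o param c) x u') k = 0.
    move=> hu' k tk; have [k' k'E] := transition_surjective k ac cx.
    rewrite -k'E -(inner_coord_gram _ _ _ (erefl p')); apply: hu'.
    rewrite JE; apply: Jd_inj; rewrite linear0 -(tangent_map_chart k' Ux).
    by rewrite k'E.
  by apply: iso; exact: hor.
Qed.

Lemma chart_local_submersion :
  local_submersion U (img d) (coord_gram (gram gbar) c) (coord_gram
    (gram g) d) F.
Proof.
split.
- exact: chart_open.
- exact: img_open.
- by move=> x [_ dx]; exact: coord_img.
- exact: chart_smooth.
- by apply: smooth_on_subset (gram_smooth gbar ac) => x [].
- exact: gram_smooth.
- by move=> x _; exact: coord_gram_sym.
- by move=> x _; exact: coord_gram_sym.
- by move=> x [cx _]; apply: posdef_unitmx => v; exact: coord_gram_pos.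
- by move=> x dx; apply: posdef_unitmx => v; exact: coord_gram_pos.
- exact: chart_cometric.
Qed.

Let a : 'rV[R]_m := coord c p.

Lemma center_domain : U a.
Proof.
by split; [exact/coord_img/chart_at_dom|rewrite coordK; exact: chart_at_dom].
Qed.

End Submersion.

Theorem theorem1 (R : realType) (m n : nat)
    (Mbar : manifold R m) (gbar : metric Mbar)
    (M : manifold R n) (g : metric M) (pi : Mbar -> M) :
  riemannian_submersion gbar g pi ->
  strongly_positive gbar ->
  strongly_positive g.
Proof.
move=> sub pos q; have [p <-] : exists p, pi p = q by case: sub.
have [w0 [Rbop [Wbop [altw RbE w0E Rpos]]]] := pos p.
set c := chart_at p; set d := chart_at (pi p); set a := coord c p.
have ls := chart_local_submersion sub p.
have Ua := center_domain pi p.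
have FE : coord d (pi (param c a)) = coord d (pi p) by rewrite coordK//;
    exact: chart_at_dom.
pose F := coord d \o pi \o param c.
have FaE : F a = coord d (pi p) by exact: FE.
pose Gb := coord_gram (gram gbar) c.
pose G := coord_gram (gram g) d.
rewrite -/c -/d -/F -/Gb -/G in ls.
have GbE : Gb a = gram gbar p by exact: coord_gram_center.
have GE : G (F a) = gram g (pi p) by rewrite FaE; exact: coord_gram_center.
pose H := horizontal_lift Gb G F a.
have HJ : H *m 'J F a = 1%:M by exact: (lift_jacobian ls Ua).
have HK (x : 'rV[R]_n) : x *m H *m vertical Gb G F a = 0.
  by rewrite -mulmxA (lift_vertical ls Ua) mulmx0.
have dFH (x : 'rV[R]_n) : 'D_(x *m H) F a = x.
  by rewrite (derive_jacobian ls _ Ua) -mulmxA HJ mulmx1.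
(* Twice the lowered O'Neill tensor on the lifts of [x] and [y], up to sign; this explains the
   factors [4^-1] below. *)
pose v (x y : 'rV[R]_n) : 'rV[R]_m :=
  vshape Gb G F a (x *m H) (y *m H) - vshape Gb G F a (y *m H) (x *m H).
have dK : differentiable (vertical Gb G F) a.
  exact: smooth_differentiable (smooth_vertical ls) Ua.
have vl y : linear (v^~ y).
  move=> k x x'; rewrite /v /vshape !mulmxDl -!scalemxAl !deriveE//.
  rewrite linearP mulmxDr -scalemxAr scalerBr opprD addrACA.
  by [].
have vC x y : v x y = - v y x by rewrite /v opprB.
have symGb := gram_sym gbar p; have posGb := @gram_pos _ _ _ gbar p.
have symL : (invmx (gram gbar p))^T = invmx (gram gbar p).
  by rewrite trmx_inv symGb.
have posL u : 0 <= inner (invmx (gram gbar p)) u u by exact: inner_invmx_ge0.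
have RmE x y z w : riemann g (pi p) x y z w =
    riemann gbar p (x *m H) (y *m H) (z *m H) (w *m H)
    + 3 * (4^-1 * inner (invmx (gram gbar p)) (v x y) (v z w))
    - (4^-1 * inner (invmx (gram gbar p)) (v x y) (v z w)
       + 4^-1 * inner (invmx (gram gbar p)) (v y z) (v x w)
       + 4^-1 * inner (invmx (gram gbar p)) (v z x) (v y w)).
  (* Constant fields in the preferred charts at [p] and [pi p] are those of [riemann], and [dFH]
     turns the derivatives of [F] along lifts back into the given vectors. *)
  have := oneill_curvature ls Ua (HK x) (HK y) (HK z) (HK w).
  by rewrite !dFH GE FaE /oneill_form GbE.
exact: (positive_descends symGb (gram_sym g _) (posdef_unitmx
  (@gram_pos _ _ _ g _))
  symL posL HJ vl vC altw RbE w0E Rpos RmE).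
Qed.
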